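(* The stochastic MDP (S-MDP) framework strictly subsumes the stochastic extreme-value MDP (EV-MDP) and the entropy-regularized MDP (ER-MDP) frameworks.
   Context: Setting. An MDP model is specified by a tuple $(\mathcal S,\mathcal A,q,\gamma)$ with $\mathcal S$ a finite set of states, $\mathcal A$ a finite set of actions, $q(s'|s,a)$ the transition probabilities, $\gamma\in[0,1]$ the discount factor, together with the extra data below; the reward function $r=(r(a|s))\in\mathbb R^{|\mathcal S|\times|\mathcal A|}$ is an input to the model. $\Delta^\pi$ is the set of policies $\pi$ with $\pi(a|s)\ge0$, $\sum_a\pi(a|s)=1$ for all $s$; $\pi_s=(\pi(a|s))_{a\in\mathcal A}$. Trajectories are $\tau=(s_0,a_0,s_1,a_1,\dots)$. S-MDP: the reward is $r(a|s)+\epsilon(a|s)$, where $r(a|s)$ is deterministic and the random noise vectors $\epsilon_s=(\epsilon(a|s))_{a\in\mathcal A}$ follow given distributions $d_s$, $s\in\mathcal S$, which are continuous and independent over states; the components of $\epsilon_s$ are not required to be i.i.d. At time $t$ and state $s$, under the realization $\epsilon_s$ of the noise, the agent takes the action $\psi^t(s|\epsilon_s)\in\mathcal A$ given by a deterministic decision rule. The value function is $V(s)=\sup_{\psi^0,\psi^1,\dots}\mathbb E_\epsilon\big[\mathbb E_\tau[\sum_{t\ge0}\gamma^t(r(a_t|s_t)+\epsilon(a_t|s_t))\mid s_0=s]\big]$. An optimal decision rule is $\psi(s|\epsilon_s)=\mathrm{argmax}_{a\in\mathcal A}\{r(a|s)+\epsilon(a|s)+\gamma\sum_{s'}q(s'|s,a)V(s')\}$,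 and the associated policy is $\pi(a|s)=\mathbb P_\epsilon(\psi(s|\epsilon_s)=a)$. The S-MDP framework is the set of all such models, each specified by $\{d_s,s\in\mathcal S\}$. EV-MDP: the S-MDP models in which $\epsilon(a|s)$ is $\eta$ times a Gumbel (Extreme Value Type I) variable, i.i.d. over all $(a,s)$, with parameter $\eta>0$. ER-MDP (parameter $\eta>0$): $V(s)=\sup_{\pi^t\in\Delta^\pi,\,t\ge0}\mathbb E_{\tau}[\sum_{t\ge0}\gamma^t(r(a_t|s_t)+\phi_{s_t}(\pi^t_{s_t}))\mid s_0=s]$ with $\phi_s(\pi_s)=-\eta\sum_{a\in\mathcal A}\pi(a|s)\ln\pi(a|s)$. Equivalence of models: two models $X,Y$ are equivalent, $X\equiv Y$, if and only if they are specified by the same tuple $(\mathcal S,\mathcal A,q,\gamma)$ and there is a constant vector $\alpha$ of size $|\mathcal S|\times|\mathcal A|$ such that, for any reward functions $r^X,r^Y\in\mathbb R^{|\mathcal S|\times|\mathcal A|}$ with $r^X-r^Y=\alpha$, model $X$ with rewards $r^X$ and model $Y$ with rewards $r^Y$ always yield the same value function and a common stationary optimal policy $\{\pi^*(a|s),\ \forall a,s\}$. Strict subsumption: a framework (set of models) $\mathcal X$ strictly subsumes a framework $\mathcal Y$ if and only if for any $Y\in\mathcal Y$ there is always $X\in\mathcal X$ with $X\equiv Y$, but there is $X\in\mathcal X$ such that no $Y\in\mathcal Y$ is equivalent to $X$.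
   Formalization: For discount factor γ = 1, equivalence here asks only for equal (possibly infinite) value functions, not a common stationary optimal policy: with γ = 1 an ER-MDP can have infinite value attained by no stationary policy, so the claim as worded fails there. *)

(* Defs.v *)
From HB Require Import structures.
From mathcomp Require Import all_boot all_order all_algebra.
From mathcomp Require Import all_classical all_reals all_analysis.

Set Implicit Arguments.
Unset Strict Implicit.
Unset Printing Implicit Defensive.

Import Order.TTheory GRing.Theory Num.Theory.
Import numFieldNormedType.Exports.

Local Open Scope classical_set_scope.
Local Open Scope ring_scope.

Record mdp (R : realType) := MDP {
  state : finType;
  action : finType;
  trans : state -> action -> state -> R; (* [trans s a s'] is q(s'|s,a) *)
  discount : R;
  state_gt0 : (0 < #|state|)%N;
  action_gt0 : (0 < #|action|)%N;
  trans_ge0 : forall s a s', 0 <= trans s a s';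
  trans_sum1 : forall s a, \sum_s' trans s a s' = 1;
  discount_ge0 : 0 <= discount;
  discount_le1 : discount <= 1 }.

Section Frameworks.
Variable R : realType.
Implicit Type M : mdp R.

(* Both rewards r(a|s) and policies pi(a|s) are written state first. *)
Definition reward M := state M -> action M -> R.
Definition policy M := state M -> action M -> R.

Definition is_policy M (pi : policy M) : Prop :=
  (forall s a, 0 <= pi s a) /\ (forall s, \sum_a pi s a = 1).

(* All that equivalence sees of a model over the tuple M: its value function
   (extended real, since it may be infinite when the discount factor is 1) and
   its stationary optimal policies, both as functions of the input reward. *)
Record model M := Model {
  value : reward M -> state M -> \bar R;
  optimal : reward M -> policy M -> Prop }.

(* The restriction to discount < 1 concerns the policies only. With discount 1
   the supremum defining the value need not be attained by a stationary policy,
   so that requiring one would leave some models with no equivalent at all. *)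
Definition equivalent M (X Y : model M) : Prop :=
  exists alpha : state M -> action M -> R,
    forall rX rY : reward M,
      (forall s a, rX s a - rY s a = alpha s a) ->
      (forall s, value X rX s = value Y rY s) /\
      (discount M < 1 -> exists pi, optimal X rX pi /\ optimal Y rY pi).

(* A framework is a set of models. It is fibred over the tuples, since models
   over different tuples are never equivalent. *)
Definition framework := forall M, set (model M).

Definition strictly_subsumes (FX FY : framework) : Prop :=
  (forall M (Y : model M), FY M Y -> exists2 X, FX M X & equivalent X Y) /\
  (exists M (X : model M), FX M X /\ forall Y, FY M Y -> ~ equivalent X Y).

(* Noise vectors, indexed by the actions through [enum_rank]. Tuples carry the
   product sigma-algebra. *)
Definition noise M := #|action M|.-tuple (measurableTypeR R).
Definition ncoord M (e : noise M) (a : action M) : R := tnth e (enum_rank a).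

Definition noise_law M := state M -> probability (noise M) R.

Definition rule M := state M -> noise M -> action M.

Definition measurable_rule M (psi : rule M) : Prop :=
  forall s a, measurable [set e : noise M | psi s e = a].

(* Null sets of n-dimensional Lebesgue measure, by coverings with boxes. *)
Definition lebesgue_null n (N : set (n.-tuple R)) : Prop :=
  forall delta : R, 0 < delta ->
  exists l u : nat -> n.-tuple R,
    [/\ forall k i, tnth (l k) i <= tnth (u k) i,
        N `<=` \bigcup_k [set x | forall i,
          tnth (l k) i <= tnth x i <= tnth (u k) i] &
        (\sum_(0 <= k <oo) (\prod_i (tnth (u k) i - tnth (l k) i))%:E
          <= delta%:E)%E].

Definition abs_continuous n (P : probability (n.-tuple (measurableTypeR R)) R) :
  Prop :=
  forall N, measurable N -> lebesgue_null N -> P N = 0%E.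

Section StochasticMDP.
Variables (M : mdp R) (d : noise_law M).
Local Notation gamma := (discount M).
Local Notation q := (@trans R M).

(* A trajectory lists the steps (t, s_t, a_t, eps_t). *)
Definition sstep : Type := nat * state M * action M * noise M.

(* [sexpect psi t n s f] is the expectation of f over the trajectory of n steps
   that starts from state s at time t: fresh noise with law [d s_t] is drawn at
   each step, then s_{t+1} is drawn from q(.|s_t,a_t). Only the noise of the
   visited states is drawn, the other states' being independent of it. *)
Fixpoint sexpect (psi : nat -> rule M) (t n : nat) (s : state M)
    (f : seq sstep -> R) : R :=
  if n is n'.+1 then
    \int[d s]_e (\sum_s' q s (psi t s e) s' *
      sexpect psi t.+1 n' s' (fun tau => f ((t, s, psi t s e, e) :: tau)))
  else f [::].

Definition sreturn (r : reward M) (tau : seq sstep) : R :=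
  \sum_(x <- tau) let: (t, s, a, e) := x in gamma ^+ t * (r s a + ncoord e a).

(* The limit of the finite-horizon expectations exists when gamma < 1; the
   lower limit also covers gamma = 1. *)
Definition sgain (r : reward M) (psi : nat -> rule M) (s : state M) : \bar R :=
  limn_einf (fun n => (sexpect psi 0 n s (sreturn r))%:E).

Definition svalue (r : reward M) (s : state M) : \bar R :=
  ereal_sup [set sgain r psi s | psi in
    [set psi : nat -> rule M | forall t, measurable_rule (psi t)]].

Definition sQ (r : reward M) (s : state M) (e : noise M) (a : action M) :
  \bar R :=
  ((r s a + ncoord e a)%:E +
   gamma%:E * \sum_s' (q s a s')%:E * svalue r s')%E.

Definition optimal_rule (r : reward M) (psi : rule M) : Prop :=
  measurable_rule psi /\
  forall s e a, (sQ r s e a <= sQ r s e (psi s e))%E.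

Definition soptimal (r : reward M) (pi : policy M) : Prop :=
  exists2 psi, optimal_rule r psi &
    forall s a, (pi s a)%:E = d s [set e | psi s e = a].

Definition smodel : model M := Model svalue soptimal.

Definition integrable_noise : Prop :=
  forall s a, (d s).-integrable setT (fun e => (ncoord e a)%:E).

Definition continuous_noise : Prop := forall s, abs_continuous (d s).

(* eta times a standard Gumbel variable, independently over the actions, with the
   same eta in all states; independence over the states is part of [sexpect]. *)
Definition iid_gumbel (eta : R) : Prop :=
  (forall s a x, d s [set e | ncoord e a / eta <= x] =
    (expR (- expR (- x)))%:E) /\
  (forall s (B : action M -> set R), (forall a, measurable (B a)) ->
    fine (d s [set e | forall a, B a (ncoord e a)]) =
    \prod_a fine (d s [set e | B a (ncoord e a)])).

End StochasticMDP.

Section EntropyRegularizedMDP.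
Variables (M : mdp R) (eta : R).
Local Notation gamma := (discount M).
Local Notation q := (@trans R M).

(* [ln 0 = 0], so that actions of probability zero contribute nothing. *)
Definition entropy_reg (p : action M -> R) : R :=
  - eta * \sum_a p a * ln (p a).

Definition estep : Type := nat * state M * action M.

Fixpoint eexpect (pi : nat -> policy M) (t n : nat) (s : state M)
    (f : seq estep -> R) : R :=
  if n is n'.+1 then
    \sum_a pi t s a * \sum_s' q s a s' *
      eexpect pi t.+1 n' s' (fun tau => f ((t, s, a) :: tau))
  else f [::].

Definition ereturn (r : reward M) (pi : nat -> policy M) (tau : seq estep) : R :=
  \sum_(x <- tau) let: (t, s, a) := x in
    gamma ^+ t * (r s a + entropy_reg (pi t s)).

Definition egain (r : reward M) (pi : nat -> policy M) (s : state M) : \bar R :=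
  limn_einf (fun n => (eexpect pi 0 n s (ereturn r pi))%:E).

Definition evalue (r : reward M) (s : state M) : \bar R :=
  ereal_sup [set egain r pi s | pi in
    [set pi : nat -> policy M | forall t, is_policy (pi t)]].

Definition eoptimal (r : reward M) (pi : policy M) : Prop :=
  is_policy pi /\ forall s, egain r (fun=> pi) s = evalue r s.

Definition emodel : model M := Model evalue eoptimal.

End EntropyRegularizedMDP.

(* Integrability is what makes the expected rewards meaningful; continuity is
   absolute continuity, which makes ties in the argmax negligible. *)
Definition SMDP : framework := fun M =>
  [set X | exists d : noise_law M,
    [/\ continuous_noise d, integrable_noise d & X = smodel d]].

Definition EVMDP : framework := fun M =>
  [set X | exists (d : noise_law M) (eta : R),
    [/\ 0 < eta, iid_gumbel d eta, continuous_noise d, integrable_noise d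
      & X = smodel d]].

Definition ERMDP : framework := fun M =>
  [set X | exists2 eta : R, 0 < eta & X = emodel M eta].

End Frameworks.

(* Main.v *)
From HB Require Import structures.
Require Import Defs.
From mathcomp Require Import all_boot all_order all_algebra.
From mathcomp Require Import all_classical all_reals all_analysis.
From mathcomp Require Import measurable_realfun ring lra.

(** EV models are S-MDP models, and a model is equivalent to itself with a zero
    reward shift as soon as an argmax can be chosen measurably, so the content
    is the inclusion of the ER models and the strictness of both inclusions.

    ER models.  The entropic model of parameter [eta] is the stochastic model
    whose noise is, in every state, a vector of independent Gumbel variables of
    scale [eta].  The link is a static duality.  A decision rule [f] at one
    state matters only through its action probabilities [p] and its expected
    noise, and for Gumbel noise of mean [c]
      - the expected noise of [f] is at most [c] plus the entropy bonus of [p]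
        ([rule_noise_le_entropy]);
      - every probability vector [p] is the law of some rule attaining this
        bound ([exists_rule_with_law]).
    Both come from one computation: the maximum over a set [A] of actions of
    [v a] plus the noise is again Gumbel, hence has mean
    [c + eta * ln (\sum_(a in A) expR (v a / eta))] ([argmax_rule_mean]).
    The bound follows by comparing [f] with the argmax for [v = eta * ln p].
    That this argmax has law [p] follows by raising one coordinate of [v]: the
    action probability is a subgradient of the mean of the maximum.

    The finite-horizon return of either model depends only on the policy and on
    the one-step gains ([eexpect_hreturn], [sexpect_hreturn]), so after the
    reward shift by [c] the duality matches the two suprema one rule sequence
    or policy sequence at a time ([svalue_evalue]).  This includes the discount
    factor 1, where the value may be infinite.  For a discount factor
    below 1, the policy of an optimal rule is greedy for the entropic Bellman
    operator at the common value, and a greedy policy attains the value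
    ([greedy_eoptimal], [optimal_rule_eoptimal]).

    Strictness.  Take one state, two actions, discount factor 0 and noise
    uniform on the unit square.  If the rewards differ by 2, every optimal
    policy gives the worse action probability 0.  A Gumbel noise has full
    support and the entropy has infinite slope at the boundary, so in the EV
    and ER models every optimal policy gives both actions positive probability
    whatever the rewards ([gumbel_optimal_true], [entropic_optimal_true]); no
    reward shift reconciles the two. *)

Set Implicit Arguments.
Unset Strict Implicit.
Unset Printing Implicit Defensive.

Import Order.TTheory GRing.Theory Num.Theory.
Import numFieldNormedType.Exports.

Local Open Scope classical_set_scope.
Local Open Scope ring_scope.

(** * Finite-horizon returns *)

Section LowerLimit.
Variable R : realType.

Lemma le_limn_einf (u v : nat -> \bar R) :
  (forall n, (u n <= v n)%E) -> (limn_einf u <= limn_einf v)%E.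
Proof.
move=> uv; rewrite !limn_einf_lim; apply: lee_lim.
- exact: is_cvg_einfs.
- exact: is_cvg_einfs.
- apply: nearW => n; rewrite /einfs; apply: le_ereal_inf_tmp => _ [m /= nm <-].
  by apply: le_trans (uv m); apply: ereal_inf_lbound; exists m.
Qed.

Lemma cvg_limn_einf (u : nat -> R) (x : R) :
  u n @[n --> \oo] --> x -> limn_einf (fun n => (u n)%:E) = x%:E.
Proof.
move=> ux; have uEx : (u n)%:E @[n --> \oo] --> x%:E.
  by apply: cvg_EFin ux; exact: nearW.
by rewrite is_cvg_limn_einfE ?(cvg_lim _ uEx)//; apply/cvg_ex; exists x%:E.
Qed.

End LowerLimit.

Section Returns.
Variables (R : realType) (M : mdp R).
Local Notation gamma := (discount M).
Local Notation q := (@trans R M).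
Implicit Types (pi : policy M) (r : reward M).

(** Averages commute with affine maps because their weights sum to 1; this lets
    the discount power of a return be pulled out of the expectation. *)
Lemma trans_avgD s a (x : R) (h : state M -> R) (y : R) :
  \sum_s' q s a s' * (x + y * h s') = x + y * \sum_s' q s a s' * h s'.
Proof.
under eq_bigr do rewrite mulrDr mulrCA.
by rewrite big_split/= -mulr_suml trans_sum1 mul1r -mulr_sumr.
Qed.

Lemma policy_avgD pi s (x : R) (h : action M -> R) (y : R) : is_policy pi ->
  \sum_a pi s a * (x + y * h a) = x + y * \sum_a pi s a * h a.
Proof.
move=> [_ pi1]; under eq_bigr do rewrite mulrDr mulrCA.
by rewrite big_split/= -mulr_suml pi1 mul1r -mulr_sumr.
Qed.

Lemma le_trans_avg s a (h h' : state M -> R) : (forall s', h s' <= h' s') ->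
  \sum_s' q s a s' * h s' <= \sum_s' q s a s' * h' s'.
Proof. by move=> hh; apply: ler_sum => s' _; rewrite ler_wpM2l// trans_ge0. Qed.

Lemma le_policy_avg pi s (h h' : action M -> R) : is_policy pi ->
  (forall a, h a <= h' a) -> \sum_a pi s a * h a <= \sum_a pi s a * h' a.
Proof. by move=> [pi0 _] hh; apply: ler_sum => a _; rewrite ler_wpM2l. Qed.

Definition next_mean pi (h : state M -> R) s : R :=
  \sum_a pi s a * \sum_s' q s a s' * h s'.

Lemma le_next_mean pi h h' s : is_policy pi -> (forall s', h s' <= h' s') ->
  next_mean pi h s <= next_mean pi h' s.
Proof.
by move=> ppi hh; apply: le_policy_avg => // a; exact: le_trans_avg.
Qed.

Lemma next_meanD pi h s (x y : R) : is_policy pi ->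
  next_mean pi (fun s' => x + y * h s') s = x + y * next_mean pi h s.
Proof.
move=> ppi; rewrite -policy_avgD//; apply: eq_bigr => a _.
by rewrite trans_avgD.
Qed.

(** The [n]-step return from time [t] under policies [p] and one-step gains [u],
    discounted from time [t] on rather than from time 0: both models' returns are
    [gamma ^+ t] times such a quantity, and its recursion is free of powers. *)
Fixpoint hreturn (p : nat -> policy M) (u : nat -> state M -> R) n t s : R :=
  if n is n'.+1 then u t s + gamma * next_mean (p t) (hreturn p u n' t.+1) s else 0.

Lemma le_hreturn p u u' n t s : (forall t, is_policy (p t)) ->
  (forall t s, u t s <= u' t s) -> hreturn p u n t s <= hreturn p u' n t s.
Proof.
move=> pp uu; elim: n t s => [//|n IH] t s /=.
by rewrite lerD// ler_wpM2l ?discount_ge0// le_next_mean.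
Qed.

Lemma eq_hreturn p p' u u' n t s : (forall t s a, p t s a = p' t s a) ->
  (forall t s, u t s = u' t s) -> hreturn p u n t s = hreturn p' u' n t s.
Proof.
move=> pp uu; have -> : p = p'.
  by apply/funext => ?; apply/funext => ?; exact/funext.
by have -> : u = u' by apply/funext => ?; exact/funext.
Qed.

Lemma hreturn_shift p u n t s :
  hreturn p u n t.+1 s = hreturn (p \o succn) (u \o succn) n t s.
Proof.
elim: n t s => [//|n IH] t s /=; congr (_ + _ * _).
by apply: eq_bigr => a _; congr (_ * _); apply: eq_bigr => s' _; rewrite IH.
Qed.

(** Gain of one step: the expected reward plus what the model adds to it, the
    entropy bonus in one model and the expected noise in the other. *)
Definition gain1 (bonus : state M -> R) r pi s : R :=
  \sum_a pi s a * r s a + bonus s.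

Section entropy.
Variable eta : R.

Definition egain1 r pi s := gain1 (fun s => entropy_reg eta (pi s)) r pi s.

(** The constant [c] is what the induction carries: the gains of the steps
    already taken, which do not depend on the rest of the trajectory. *)
Lemma eexpect_hreturn r (pi : nat -> policy M) n t s c :
  (forall t, is_policy (pi t)) ->
  eexpect pi t n s (fun tau => c + ereturn eta r pi tau) =
  c + gamma ^+ t * hreturn pi (fun t => egain1 r (pi t)) n t s.
Proof.
move=> ppi; elim: n t s c => [|n IH] t s c /=.
  by rewrite /ereturn big_nil mulr0.
pose x a := c + gamma ^+ t * (r s a + entropy_reg eta (pi t s)).
have E a : (fun tau => c + ereturn eta r pi ((t, s, a) :: tau)) =
    (fun tau => x a + ereturn eta r pi tau).
  by apply/funext => tau; rewrite /ereturn big_cons/= addrA.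
under eq_bigr => a _.
  under eq_bigr => s' _ do rewrite E IH.
  rewrite trans_avgD /x exprSr -!mulrA -addrA -mulrDr.
  over.
rewrite policy_avgD//; congr (_ + _ * _).
rewrite /egain1 /gain1 /next_mean -addrA [in RHS]addrA.
under eq_bigr => a _ do rewrite -[_ + _ + _]addrA mulrDr.
rewrite big_split/= -addrA; congr (_ + _).
by rewrite policy_avgD.
Qed.

Lemma egain_hreturn r (pi : nat -> policy M) s : (forall t, is_policy (pi t)) ->
  egain eta r pi s =
  limn_einf (fun n => (hreturn pi (fun t => egain1 r (pi t)) n 0 s)%:E).
Proof.
move=> ppi; rewrite /egain; congr limn_einf; apply/funext => n; congr (_%:E).
rewrite -[RHS]mul1r -[1]/(gamma ^+ 0) -[RHS]add0r -eexpect_hreturn//.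
by congr eexpect; apply/funext => tau; rewrite add0r.
Qed.

End entropy.
End Returns.

(** * Greedy policies of the entropic model *)

Section Discounted.
Variables (R : realType) (M : mdp R).
Local Notation gamma := (discount M).
Hypothesis gamma_lt1 : gamma < 1.

Let gamma_ge0 : 0 <= gamma := discount_ge0 M.

Let cvg_discount (x K : R) : x + gamma ^+ n * K @[n --> \oo] --> x.
Proof.
rewrite -[X in _ --> X]addr0 -(mul0r K); apply: cvgD; first exact: cvg_cst.
by apply: cvgMl; apply: cvg_expr; rewrite ger0_norm.
Qed.

Let limn_einf_le (u : nat -> R) (x K : R) :
  (forall n, u n <= x + gamma ^+ n * K) ->
  (limn_einf (fun n => (u n)%:E) <= x%:E)%E.
Proof.
move=> ux; rewrite -(cvg_limn_einf (@cvg_discount x K)).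
by apply: le_limn_einf => n; rewrite lee_fin.
Qed.

Let limn_einf_ge (u : nat -> R) (x K : R) :
  (forall n, x <= u n + gamma ^+ n * K) ->
  (x%:E <= limn_einf (fun n => (u n)%:E))%E.
Proof.
move=> ux; rewrite -(cvg_limn_einf (@cvg_discount x (- K))).
by apply: le_limn_einf => n; rewrite lee_fin mulrN lerBlDr.
Qed.

Section BoundedGains.
Variables (p : nat -> policy M) (u : nat -> state M -> R) (B : R).
Hypotheses (policyp : forall t, is_policy (p t))
  (uB : forall t s, `|u t s| <= B).

Let next_mean_norm t (h : state M -> R) (K : R) s : (forall s, `|h s| <= K) ->
  `|next_mean (p t) h s| <= K.
Proof.
move=> hK; have cst x : next_mean (p t) (fun=> x) s = x.
  by have := next_meanD (fun=> 0) s x 0 (policyp t); rewrite !mul0r addr0.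
rewrite ler_norml -{1}(cst (- K)) -{2}(cst K) !le_next_mean//= => s'.
  by have := hK s'; rewrite ler_norml => /andP[].
by have := hK s'; rewrite ler_norml => /andP[].
Qed.

Lemma hreturn_norm n t s : `|hreturn p u n t s| <= B / (1 - gamma).
Proof.
have g1 : 0 < 1 - gamma by rewrite subr_gt0.
elim: n t s => [|n IH] t s /=.
  by rewrite normr0 divr_ge0 ?(ltW g1)// (le_trans _ (uB t s)).
rewrite (le_trans (ler_normD _ _))// normrM (ger0_norm gamma_ge0).
have := next_mean_norm t s (IH t.+1); have := uB t s.
set x := `|_|; set y := `|_| => xB yB.
have -> : B / (1 - gamma) = B + gamma * (B / (1 - gamma)).
  by field; rewrite gt_eqF.
by rewrite lerD// ler_wpM2l.
Qed.

(** The steps after the [n]-th are worth at least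
    [- gamma ^+ n * (B / (1 - gamma))].  Letting [m] grow bounds a
    finite-horizon return by the lower limit of the returns. *)
Lemma hreturn_tail n m t s : (n <= m)%N ->
  hreturn p u n t s <= hreturn p u m t s + gamma ^+ n * (B / (1 - gamma)).
Proof.
move=> /subnKC <-; move: (m - n)%N => k; elim: n t s => [|n IH] t s.
  have := hreturn_norm k t s; rewrite ler_norml => /andP[+ _].
  by rewrite expr0 mul1r /=; lra.
rewrite addSn /= -addrA lerD2l exprS -mulrA -mulrDr ler_wpM2l//.
rewrite addrC -[X in _ + X]mul1r -next_meanD// le_next_mean// => s'.
by rewrite mul1r addrC; exact: IH.
Qed.

End BoundedGains.

Section EntropicBellman.
Variables (eta : R) (r : reward M).

(** [x * ln x] stays above [-1] on the unit interval, since [ln x^-1] is at most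
   [x^-1 - 1]. *)
Let gain_bounded : exists B, forall pi s, is_policy pi ->
  `|egain1 eta r pi s| <= B.
Proof.
exists (\sum_s \sum_a `|r s a| + `|eta| * #|action M|%:R) => pi s [pi0 pi1].
have pile1 a : pi s a <= 1.
  by rewrite -(pi1 s) (bigD1 a)//= lerDl sumr_ge0.
rewrite (le_trans (ler_normD _ _))// lerD//.
  rewrite [leRHS](bigD1 s)//= ler_wpDr//.
    by apply: sumr_ge0 => ? _; exact: sumr_ge0.
  rewrite (le_trans (ler_norm_sum _ _ _))//; apply: ler_sum => a _.
  by rewrite normrM (ger0_norm (pi0 s a)) ler_piMl.
rewrite /entropy_reg normrM normrN ler_wpM2l// -sum1_card natr_sum.
rewrite (le_trans (ler_norm_sum _ _ _))//; apply: ler_sum => a _.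
have := pi0 s a; rewrite le_eqVlt => /predU1P[<-|pi_gt0].
  by rewrite mul0r normr0.
rewrite ler0_norm; last by rewrite mulr_ge0_le0// ln_le0.
rewrite -mulrN -lnV ?posrE//.
have := @le_ln1Dx _ ((pi s a)^-1 - 1); rewrite [1 + _]addrC subrK.
move=> /(_ _)/(ler_wpM2l (pi0 s a)); rewrite mulrBr mulfV ?gt_eqF// => le1.
apply: le_trans (le1 _) _; last by rewrite mulr1 lerBlDr lerDl.
by rewrite ltrBrDl subrr invr_gt0.
Qed.

Lemma evalue_fin_num s : evalue eta r s \is a fin_num.
Proof.
have [B rB] := gain_bounded; rewrite fin_numE -leeNy_eq -leye_eq -!ltNge.
have gain_norm pi : (forall t, is_policy (pi t)) ->
    ((- (B / (1 - gamma)))%:E <= egain eta r pi s <= (B / (1 - gamma))%:E)%E.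
  move=> ppi; rewrite egain_hreturn//.
  have uB t s' : `|egain1 eta r (pi t) s'| <= B by exact: rB.
  apply/andP; split.
    apply: (@limn_einf_ge _ _ 0) => n; rewrite mulr0 addr0.
    by have := hreturn_norm ppi uB n 0 s; rewrite ler_norml => /andP[].
  apply: (@limn_einf_le _ _ 0) => n; rewrite mulr0 addr0.
  by have := hreturn_norm ppi uB n 0 s; rewrite ler_norml => /andP[].
have [a0 _] : exists a : action M, true.
  by have /card_gt0P[a _] := action_gt0 M; exists a.
pose pi0 : policy M := fun _ a => (a == a0)%:R.
have ppi0 : is_policy pi0.
  split=> [s' a|s']; first by rewrite ler0n.
  by rewrite (bigD1 a0)//= /pi0 eqxx big1 ?addr0// => a /negbTE ->.
apply/andP; split.
  apply: lt_le_trans (ltNyr (- (B / (1 - gamma)))) _.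
  apply: le_ereal_sup_tmp; exists (egain eta r (fun=> pi0) s).
    by exists (fun=> pi0).
  by have /andP[] := gain_norm (fun=> pi0) (fun=> ppi0).
apply: le_lt_trans (ltry (B / (1 - gamma))).
by apply: ge_ereal_sup => _ [pi ppi <-]; have /andP[] := gain_norm pi ppi.
Qed.

Let W s := fine (evalue eta r s).

(** The return over [n] steps is within the discounted tail of the lower limit,
    which the value bounds. *)
Let hreturn_le_value (B : R) (pi : nat -> policy M) n s :
  (forall pi s, is_policy pi -> `|egain1 eta r pi s| <= B) ->
  (forall t, is_policy (pi t)) ->
  hreturn pi (fun t => egain1 eta r (pi t)) n 0 s <=
    W s + gamma ^+ n * (B / (1 - gamma)).
Proof.
move=> rB ppi; rewrite -lerBlDr -lee_fin fineK ?evalue_fin_num//.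
have uB t s' : `|egain1 eta r (pi t) s'| <= B by exact: rB.
apply: (@le_trans _ _ (egain eta r pi s)); last first.
  by apply: ereal_sup_ubound; exists pi.
rewrite egain_hreturn// limn_einf_lim.
apply: lime_ge; first exact: is_cvg_einfs.
exists n => // k /= nk; apply: le_ereal_inf_tmp => _ [m /= km <-].
by rewrite lee_fin lerBlDr; apply: hreturn_tail => //; exact: leq_trans km.
Qed.

(** Let [T] be the operator of the one-step problem and [T_pi] the one of [pi].
    The first step of any policy sequence gives [W <= T W], and greediness says
    [T W <= T_pi W].  Iterating the monotone operator [T_pi] on [W <= T_pi W]
    gives that [W] is at most the [n]-step return of [pi] up to a term of order
    [gamma ^+ n]. *)
Lemma greedy_eoptimal (pi : policy M) : is_policy pi ->
  (forall pi' s, is_policy pi' ->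
    egain1 eta r pi' s + gamma * next_mean pi' W s <=
    egain1 eta r pi s + gamma * next_mean pi W s) ->
  eoptimal eta r pi.
Proof.
move=> ppi greedy; split=> // s; have [B rB] := gain_bounded.
pose K := B / (1 - gamma).
have bellman s' : W s' <= egain1 eta r pi s' + gamma * next_mean pi W s'.
  rewrite -lee_fin fineK ?evalue_fin_num//; apply: ge_ereal_sup => _ [p pp <-].
  rewrite egain_hreturn//; set x := _ + gamma * _.
  have K0 : 0 <= K.
    by rewrite divr_ge0 ?subr_ge0 ?(ltW gamma_lt1)// (le_trans _ (rB pi s ppi)).
  (* The return over 0 steps is 0, and the [`|x|] makes the bound hold for it. *)
  apply: (@limn_einf_le _ _ (K + `|x|)) => -[|n] /=.
    by rewrite expr0 mul1r; have := ler_norm (- x); rewrite normrN; lra.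
  apply: (@le_trans _ _ (x + gamma ^+ n.+1 * K)); last first.
    by rewrite lerD2l ler_wpM2l ?exprn_ge0// lerDl.
  apply: le_trans (lerD (greedy (p 0%N) s' (pp 0%N)) (lexx _)).
  rewrite -[leRHS]addrA lerD2l exprS -mulrA -mulrDr ler_wpM2l// addrC.
  rewrite -[X in _ + X]mul1r -next_meanD// le_next_mean// => s''.
  rewrite mul1r addrC hreturn_shift.
  by have := hreturn_le_value n s'' rB (fun t => pp t.+1).
have Wreturn n t s' : W s' <= hreturn (fun=> pi) (fun=> egain1 eta r pi) n t s'
    + gamma ^+ n * \sum_s `|W s|.
  elim: n t s' => [|n IH] t s' /=.
    rewrite expr0 mul1r add0r (le_trans (ler_norm _))//.
    by rewrite (bigD1 s')//= lerDl sumr_ge0.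
  rewrite (le_trans (bellman s'))// -[leRHS]addrA lerD2l exprS -mulrA -mulrDr.
  rewrite ler_wpM2l// addrC -[X in _ + X]mul1r -next_meanD// le_next_mean// => s''.
  by rewrite mul1r addrC.
apply/eqP; rewrite eq_le; apply/andP; split.
  by apply: ereal_sup_ubound; exists (fun=> pi).
rewrite -[leLHS]fineK ?evalue_fin_num// egain_hreturn//.
by apply: (@limn_einf_ge _ _ (\sum_s `|W s|)) => n; exact: Wreturn.
Qed.

End EntropicBellman.
End Discounted.

(** * Measurable argmax *)

Section FiniteValuedMaps.
Context d (T : measurableType d).

Definition finite_valued_measurable (A : finType) (f : T -> A) :=
  forall a, measurable [set x | f x = a].

Lemma measurable_finite_valued (A : finType) (f : T -> A) (B : set A) :
  finite_valued_measurable f -> measurable [set x | B (f x)].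
Proof.
move=> mf; rewrite (_ : mkset _ = \bigcup_(a in B) [set x | f x = a]).
  by apply: fin_bigcup_measurable => // a _; exact: mf.
by apply/seteqP; split=> [x Bfx|x [a Ba /= ->]//]; exists (f x).
Qed.

(** The argmax factors through the finite function telling which entries are
    maximal; the fibres of that function are finite intersections of comparison
    sets.  Values in the extended reals serve twice: the state-action values of
    the stochastic model may be infinite, and giving a map the value [-oo]
    excludes its index from the argmax. *)
Lemma exists_measurable_argmax (A : finType) (R : realType) 
    (Q : A -> T -> \bar R) : (0 < #|A|)%N ->
  (forall a, measurable_fun [set: T] (Q a)) ->
  exists2 f : T -> A, finite_valued_measurable f &
    forall x a, (Q a x <= Q (f x) x)%E.
Proof.
move=> /card_gt0P[a0 _] mQ.
pose best x a := [forall b, Q b x <= Q a x]%E.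
have best_ex x : exists a, best x a.
  have [a _ aP] := @arg_maxP _ _ A a0 xpredT (fun a => Q a x) isT.
  by exists a; apply/forallP => b; exact: aP.
pose F x : {ffun A -> bool} := [ffun a => best x a].
pose f x := odflt a0 [pick a | best x a].
exists f => [|x a]; last first.
  rewrite /f; case: pickP => [b /forallP/(_ a)//|none].
  by have [b] := best_ex x; rewrite none.
have mF : finite_valued_measurable F.
  have mbest b0 : measurable [set x | best x b0].
    rewrite (_ : mkset _ = \bigcap_(b in [set: A]) [set x | (Q b x <= Q b0 x)%E]).
      apply: fin_bigcap_measurable => // b _.
      by rewrite -[X in measurable X]setTI; exact: measurable_lee.
    apply/seteqP; split=> x /=; first by move=> /forallP h b _; exact: h.
    by move=> h; apply/forallP => b; exact: h.
  move=> g; rewrite (_ : mkset _ = \bigcap_(a in [set: A]) [set x | best x a = g a]).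
    apply: fin_bigcap_measurable => // a _; case: (g a); first exact: mbest.
    rewrite (_ : mkset _ = ~` [set x | best x a]); first exact: measurableC.
    by apply/seteqP; split=> x /=; [move=> -> //|move/negP/negbTE].
  apply/seteqP; split=> x /=; first by move=> <- a _; rewrite ffunE.
  by move=> xg; apply/ffunP => a; rewrite ffunE; exact: xg.
move=> a; rewrite (_ : mkset _ = [set x | odflt a0 [pick a | F x a] = a]).
  exact: (measurable_finite_valued
    [set g : {ffun A -> bool} | odflt a0 [pick a | g a] = a]).
by apply/seteqP; split=> x /=; rewrite (@eq_pick _ (F x) (best x))// => b;
  rewrite ffunE.
Qed.

End FiniteValuedMaps.

(** * Action probabilities and expected noise of a rule *)

Section RuleMoments.
Variables (R : realType) (M : mdp R) (P : probability (noise M) R).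
Implicit Types f : noise M -> action M.

Definition rule_prob f a : R := fine (P [set e | f e = a]).
Definition rule_noise f : R := \int[P]_e ncoord e (f e).

Lemma measurable_ncoord a : measurable_fun [set: noise M] (fun e => ncoord e a).
Proof. exact: measurable_tnth. Qed.

Hypothesis intP : forall a, P.-integrable setT (fun e => (ncoord e a)%:E).

Lemma integrable_rule f (F : action M -> R) : finite_valued_measurable f ->
  P.-integrable setT (fun e => (F (f e))%:E).
Proof.
move=> mf; rewrite (_ : (fun _ => _) =
    (fun e => \sum_a (F a)%:E * (\1_[set e | f e = a] e)%:E)%E).
  apply: integrable_sum => // a _; apply: integrableZl => //.
  by apply: integrable_indic => //; exact: mf.
apply/funext => e; rewrite (bigD1 (f e))//= indicE mem_set// mule1.
by rewrite big1 ?adde0// => a /eqP fa; rewrite indicE memNset ?mule0//= => /esym.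
Qed.

Lemma integrable_ncoord_rule f : finite_valued_measurable f ->
  P.-integrable setT (fun e => (ncoord e (f e))%:E).
Proof.
move=> mf; rewrite (_ : (fun _ => _) =
    (fun e => \sum_a (((EFin \o \1_[set e | f e = a]) \*
      (fun e => (ncoord e a)%:E)) e))%E).
  apply: integrable_sum => // a _; apply: integrableMr => //.
  exists 1; split=> // x x1 e _ /=; rewrite indicE.
  by case: (_ \in _); rewrite ?normr1 ?normr0 ltW// (lt_trans _ x1).
apply/funext => e /=; rewrite (bigD1 (f e))//= indicE mem_set// mul1e.
by rewrite big1 ?adde0// => a /eqP fa; rewrite indicE memNset ?mul0e//= => /esym.
Qed.

Lemma Rintegral_rule f (F : action M -> R) : finite_valued_measurable f ->
  \int[P]_e F (f e) = \sum_a rule_prob f a * F a.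
Proof.
move=> mf; rewrite /Rintegral.
under eq_integral => e _.
  rewrite (_ : (F (f e))%:E = \sum_a (F a)%:E * (\1_[set e | f e = a] e)%:E)%E.
    over.
  rewrite (bigD1 (f e))//= indicE mem_set// mule1.
  by rewrite big1 ?adde0// => a /eqP fa; rewrite indicE memNset ?mule0//= => /esym.
rewrite integral_sum//; last first.
  by move=> a; apply: integrableZl => //; apply: integrable_indic => //; exact: mf.
rewrite -sum_fine; last first.
  move=> a _; apply: integrable_fin_num => //; apply: integrableZl => //.
  by apply: integrable_indic => //; exact: mf.
apply: eq_bigr => a _; rewrite integralZl//; last first.
  by apply: integrable_indic => //; exact: mf.
have mfa := mf a; rewrite integral_indic ?setIT// fineM//; first exact: mulrC.
exact: fin_num_measure.
Qed.

Lemma rule_prob_ge0 f a : 0 <= rule_prob f a.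
Proof. exact/fine_ge0/measure_ge0. Qed.

Lemma rule_prob_sum1 f : finite_valued_measurable f ->
  \sum_a rule_prob f a = 1.
Proof.
move=> mf; rewrite -[LHS](eq_bigr _ (fun a _ => mulr1 _)).
rewrite -(Rintegral_rule (fun=> 1))// Rintegral_cst//.
by rewrite mul1r; exact: (congr1 fine (probability_setT P)).
Qed.

Lemma Rintegral_rule_noise f (F : action M -> R) (w : R) :
  finite_valued_measurable f ->
  \int[P]_e (F (f e) + w * ncoord e (f e)) =
  \sum_a rule_prob f a * F a + w * rule_noise f.
Proof.
move=> mf; rewrite RintegralD//; last 2 first.
- exact: integrable_rule.
- have := @integrableZl _ _ _ P setT measurableT w _ (integrable_ncoord_rule mf).
  by apply: eq_integrable => // e _; rewrite /= EFinM.
rewrite Rintegral_rule// RintegralZl//; exact: integrable_ncoord_rule.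
Qed.

(** A pointwise comparison of two rules, each collecting at the action taken a
    constant and the noise of that action, in terms of the only data of a rule
    that the model sees. *)
Lemma le_Rintegral_rule f g (F G : action M -> R) :
  finite_valued_measurable f -> finite_valued_measurable g ->
  (forall e, F (f e) + ncoord e (f e) <= G (g e) + ncoord e (g e)) ->
  \sum_a rule_prob f a * F a + rule_noise f <=
  \sum_a rule_prob g a * G a + rule_noise g.
Proof.
move=> mf mg fg.
have E h H : finite_valued_measurable h ->
    \sum_a rule_prob h a * H a + rule_noise h = \int[P]_e (H (h e) + ncoord e (h e)).
  move=> mh; rewrite -[in LHS](mul1r (rule_noise h)) -Rintegral_rule_noise//.
  by apply: eq_Rintegral => e _; rewrite mul1r.
have I h H : finite_valued_measurable h ->
    P.-integrable setT (EFin \o (fun e => H (h e) + ncoord e (h e))).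
  move=> mh; have := integrableD measurableT (integrable_rule H mh)
    (integrable_ncoord_rule mh).
  by apply: eq_integrable.
by rewrite !E//; apply: le_Rintegral => //; exact: I.
Qed.

End RuleMoments.

(** * Laws on the line *)

Section LawsOnTheLine.
Variable R : realType.
Local Notation line := (measurableTypeR R).

Lemma exists_law_of_cdf (F : R -> R) : {homo F : x y / x <= y} ->
  continuous F -> F x @[x --> -oo] --> (0:R) -> F x @[x --> +oo] --> (1:R) ->
  exists mu : probability line R, forall x, mu `]-oo, x]%classic = (F x)%:E.
Proof.
move=> ndF cF FN Fy.
pose cumF : cumulativeBounded (0:R) (1:R) := HB.pack F
  (isCumulative.Build R _ R F ndF (right_continuousW cF))
  (isCumulativeBounded.Build R 0 1 F FN Fy).
exists (lebesgue_stieltjes_measure cumF : probability _ _) => x.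
exact: (cdf_lebesgue_stieltjes_id cumF x).
Qed.

(** The half-open intervals are stable under intersection and generate the Borel
    sets. *)
Lemma eq_law_of_cdf (mu nu : probability line R) :
  (forall x, mu `]-oo, x]%classic = nu `]-oo, x]%classic) ->
  forall A, measurable A -> mu A = nu A.
Proof.
move=> munu A; apply: (@measure_unique _ R line (@ocitv R)
  (fun n => `]-(n%:R), n%:R]%classic)) => //.
- exact: ocitvI.
- by move=> i; exists (- i%:R, i%:R).
- exact: bigcup_itvT.
- move=> _ [[a b] _ <-] /=.
  have [ab|ba] := leP a b; last first.
    by rewrite set_itv_ge ?measure0// bnd_simp -leNgt ltW.
  have -> : `]a, b]%classic = `]-oo, b]%classic `\` `]-oo, a]%classic.
    by rewrite -[RHS]setCK setCD setCitvl setUC -[LHS]setCK setCitv.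
  rewrite !measureD//=; last 2 first.
    by rewrite -ge0_fin_numE// fin_num_measure.
    by rewrite -ge0_fin_numE// fin_num_measure.
  by rewrite setIidr ?munu//; exact: subset_itvl.
- by move=> k; rewrite -ge0_fin_numE// fin_num_measure.
Qed.

Section RandomVariables.
Context d (T : measurableType d) (P : probability T R).
Implicit Types X Y : T -> R.

(** The absolute value of [X] is at most the number of naturals [n] with
    [n <= `|X|], whose integral is the sum of the tails. *)
Lemma integrable_geometric_tail X (C rho : R) :
  measurable_fun [set: T] X -> 0 <= rho < 1 ->
  (forall n, (P [set x | (n%:R <= `|X x|)%R] <= (C * rho ^+ n)%:E)%E) ->
  P.-integrable [set: T] (fun x => (X x)%:E).
Proof.
move=> mX /andP[rho0 rho1] tail; apply/integrableP; split.
  exact/measurable_EFinP.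
pose E n := [set x | n%:R <= `|X x|].
have mE n : measurable (E n).
  rewrite -[E n]setTI; apply: measurable_fun_le => //.
  exact: measurableT_comp.
have mIE n : measurable_fun [set: T] (fun x => (\1_(E n) x : R)%:E).
  by apply/measurable_EFinP; exact: measurable_indic.
apply: (@le_lt_trans _ _ (\int[P]_x \sum_(0 <= n <oo) (\1_(E n) x)%:E)%E).
  apply: ge0_le_integral => //.
  - by apply: measurableT_comp => //; exact/measurable_EFinP.
  - by apply: ge0_emeasurable_sum => // n x _ _; rewrite lee_fin.
  move=> x _ /=.
  have /andP[_ Xk] := truncn_itv (normr_ge0 (X x)).
  (* The terms of index 0 to [k] equal 1, and [k + 1] exceeds [`|X x|]. *)
  set k := Num.truncn _ in Xk.
  apply: le_trans (nneseries_lim_ge k.+1 _); last by move=> n _; rewrite lee_fin.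
  rewrite big_mkord (eq_bigr (fun=> 1%E)) => [|n _].
    by rewrite sumEFin lee_fin sumr_const card_ord ltW.
  rewrite indicE mem_set//= /E/= -truncn_ge_nat// -/k.
  by rewrite -ltnS.
rewrite integral_nneseries//.
under eq_eseriesr do rewrite integral_indic ?setIT//.
apply: (@le_lt_trans _ _ (\sum_(0 <= n <oo) (C * rho ^+ n)%:E)%E).
  by apply: lee_nneseries => n *; [exact: measure_ge0|exact: tail].
have geo : (\sum_(0 <= k < n) (C * rho ^+ k)%:E)%E @[n --> \oo] -->
    (C * (1 - rho)^-1)%:E.
  apply: cvg_EFin; first by apply: nearW => n; rewrite sumEFin.
  have := @cvg_geometric_series _ C rho; rewrite ger0_norm// => /(_ rho1).
  by apply: cvg_trans; apply: near_eq_cvg; apply: nearW => n; rewrite /= sumEFin.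
by rewrite (cvg_lim _ geo)// ltry.
Qed.

Lemma eq_mean_of_cdf X Y : P.-integrable [set: T] (fun x => (X x)%:E) ->
  P.-integrable [set: T] (fun x => (Y x)%:E) ->
  (forall x, P [set t | (X t <= x)%R] = P [set t | (Y t <= x)%R]) ->
  \int[P]_t X t = \int[P]_t Y t.
Proof.
move=> iX iY XY.
have mX : measurable_fun setT (X : T -> line).
  by case/integrableP: iX => /measurable_EFinP.
have mY : measurable_fun setT (Y : T -> line).
  by case/integrableP: iY => /measurable_EFinP.
pose XX : {mfun T >-> line} := HB.pack X (isMeasurableFun.Build _ _ _ _ _ mX).
pose YY : {mfun T >-> line} := HB.pack Y (isMeasurableFun.Build _ _ _ _ _ mY).
have E (Z : {mfun T >-> line}) : P.-integrable [set: T] (fun x => (Z x : R)%:E) ->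
    (\int[P]_t (Z t : R)%:E = \int[distribution P Z]_y (y : R)%:E)%E.
  by move=> iZ; rewrite integral_distribution.
rewrite /Rintegral (E XX)// (E YY)//; congr (fine _).
apply: eq_measure_integral => A mA _; exact: eq_law_of_cdf.
Qed.

End RandomVariables.
End LawsOnTheLine.

(** * Independent coordinates *)

Section IidNoise.
Variable R : realType.
Local Notation line := (measurableTypeR R).

Lemma measurable_box n (B : 'I_n -> set line) : (forall i, measurable (B i)) ->
  measurable [set t : n.-tuple line | forall i, B i (tnth t i)].
Proof.
move=> mB; rewrite (_ : mkset _ =
    \bigcap_(i in [set: 'I_n]) ((fun t : n.-tuple line => tnth t i) @^-1` B i)).
  apply: fin_bigcap_measurable => // i _; rewrite -[X in measurable X]setTI.
  exact: measurable_tnth.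
by apply/seteqP; split=> t tB i => [_|]; exact: tB.
Qed.

(** By induction on the number of coordinates: the law for [n + 1] is the image
    under cons of the product of [mu] and the law for [n]. *)
Lemma exists_iid_law (mu : probability line R) n :
  exists P : probability (n.-tuple line) R,
    forall B : 'I_n -> set line, (forall i, measurable (B i)) ->
    P [set t | forall i, B i (tnth t i)] = (\prod_i fine (mu (B i)))%:E.
Proof.
elim: n => [|n [P PB]].
  pose P0 : probability (0.-tuple line) R := \d_[tuple of [::]].
  exists P0 => B _.
  rewrite big_ord0 (_ : mkset _ = [set: 0.-tuple line]) //.
    exact: (probability_setT P0).
  by apply/seteqP; split=> // t _ [].
pose cons (x : line * n.-tuple line) := [the n.+1.-tuple line of x.1 :: x.2].
have mcons : measurable_fun [set: _] cons by exact: measurable_cons.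
pose Q : probability (n.+1.-tuple line) R := distribution (mu \x P)%E
  (HB.pack cons (isMeasurableFun.Build _ _ _ _ _ mcons) : {mfun _ >-> _}).
exists Q => B mB.
rewrite /Q/= /distribution /pushforward/=.
pose B' (i : 'I_n) := B (lift ord0 i).
have mB' i : measurable (B' i) by exact: mB.
have -> : cons @^-1` [set t | forall i, B i (tnth t i)] =
    B ord0 `*` [set t | forall i, B' i (tnth t i)].
  apply/seteqP; split=> [[x t]/= xtB|[x t]/= [xB tB] i].
    by split=> [|i]; [have := xtB ord0|have := xtB (lift ord0 i); rewrite tnthS].
  by have [j ->|->] := unliftP ord0 i; rewrite ?tnthS//; exact: tB.
rewrite product_measure1E//; last first.
  exact: measurable_box.
rewrite [X in (_ * X)%E](PB B' mB').
by rewrite big_ord_recl EFinM fineK ?fin_num_measure.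
Qed.
Section IidLaw.
Variables (mu : probability line R) (n : nat).
Variable P : probability (n.-tuple line) R.
Hypothesis iidP : forall B : 'I_n -> set line, (forall i, measurable (B i)) ->
  P [set t | forall i, B i (tnth t i)] = (\prod_i fine (mu (B i)))%:E.

(** A box has probability at most [C ^+ n] times its volume, and countable
    subadditivity passes this on to the coverings that define null sets. *)
Lemma iid_abs_continuous (C : R) :
  (forall a b, a <= b -> fine (mu `[a, b]%classic) <= C * (b - a)) ->
  abs_continuous P.
Proof.
move=> muC N mN N0.
have C0 : 0 <= C.
  have := muC 0 1 ler01; rewrite subr0 mulr1; apply: le_trans.
  exact/fine_ge0/measure_ge0.
suff PN (delta : R) : 0 < delta -> (P N <= (C ^+ n * delta)%:E)%E.
  have PNfin : P N \is a fin_num by exact: fin_num_measure.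
  apply/eqP; rewrite eq_le measure_ge0 andbT -(fineK PNfin) lee_fin.
  apply/ler_addgt0Pl => e e0; rewrite addr0 -lee_fin (fineK PNfin).
  have C1 : 0 < C ^+ n + 1 by rewrite ltr_wpDl ?exprn_ge0.
  apply: le_trans (PN (e / (C ^+ n + 1)) _) _; first by rewrite divr_gt0.
  rewrite lee_fin mulrCA ler_piMr ?(ltW e0)// ler_pdivrMr// mul1r.
  by rewrite lerDl.
move=> delta0; have [l [u [lu Nlu sumlu]]] := N0 delta delta0.
pose I k i : set line := `[tnth (l k) i, tnth (u k) i]%classic.
have mI k i : measurable (I k i) by exact: measurable_itv.
pose box k := [set t : n.-tuple line | forall i, I k i (tnth t i)].
have mbox k : measurable (box k) by apply: measurable_box => i; exact: mI.
have Pbox k : (P (box k) <=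
    (C ^+ n)%:E * (\prod_i (tnth (u k) i - tnth (l k) i))%:E)%E.
  rewrite iidP//.
  rewrite -EFinM lee_fin -[n in C ^+ n]card_ord -prodr_const -big_split/=.
  apply: ler_prod => i _; rewrite muC// andbT.
  exact/fine_ge0/measure_ge0.
apply: (@le_trans _ _ (\sum_(0 <= k <oo) P (box k))%E).
  exact: measure_sigma_subadditive.
apply: le_trans.
  by apply: lee_nneseries => [k *|k _]; [exact: measure_ge0|exact: Pbox].
rewrite nneseriesZl//; last first.
  by move=> k _; rewrite lee_fin prodr_ge0// => i _; rewrite subr_ge0.
by rewrite EFinM; apply: lee_wpmul2l => //; rewrite lee_fin exprn_ge0.
Qed.

Lemma iid_coordinate i (B : set line) : measurable B ->
  P [set t | B (tnth t i)] = mu B.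
Proof.
move=> mB; pose D j := if j == i then B else setT.
have -> : [set t | B (tnth t i)] = [set t : n.-tuple line | forall j, D j (tnth t j)].
  apply/seteqP; split=> t /=; first by move=> tB j; rewrite /D; case: eqP => // ->.
  by move=> /(_ i); rewrite /D eqxx.
rewrite iidP; last by move=> j; rewrite /D; case: ifP.
rewrite (bigD1 i)//= {1}/D eqxx big1 ?mulr1 ?fineK ?fin_num_measure//.
by move=> j /negbTE ji; rewrite /D ji probability_setT.
Qed.

End IidLaw.
End IidNoise.

(** * Uniform and Gumbel laws *)

Section UniformLaw.
Variable R : realType.

Lemma uniform_itv_le (a b : R) : a <= b ->
  fine (uniform_prob (@ltr01 R) `[a, b]%classic) <= 1 * (b - a).
Proof.
move=> ab; rewrite mul1r -lee_fin fineK; last exact: fin_num_measure.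
apply: (@le_trans _ _ (\int[lebesgue_measure]_(x in `[a, b]) (cst 1%:E) x)%E).
  apply: ge0_le_integral => //.
  - by move=> x _; rewrite lee_fin uniform_pdf_ge0.
  - apply/measurable_EFinP/measurable_funTS; exact: measurable_uniform_pdf.
  - move=> x _; rewrite lee_fin /uniform_pdf subr0 invr1.
    by case: ifP.
rewrite integral_cst//= mul1e lebesgue_measure_itv/= lte_fin.
by case: ifP => //; rewrite lee_fin subr_ge0.
Qed.

Lemma uniform_unit_itv : uniform_prob (@ltr01 R) `[0, 1]%classic = 1%E.
Proof. exact: integral_uniform_pdf1. Qed.

End UniformLaw.

Lemma mul_subr_expR_le1 (R : realType) (u : R) : (1 - u) * expR u <= 1.
Proof.
have := expR_ge1Dx (- u); rewrite expRN => eNu; have e0 := expR_gt0 u.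
by rewrite -[leRHS](mulVf (lt0r_neq0 e0)) ler_wpM2r// ltW.
Qed.

Section GumbelLaw.
Variables (R : realType) (eta : R).
Hypothesis eta_gt0 : 0 < eta.
Local Notation line := (measurableTypeR R).

Definition gumbel_cdf (x : R) : R := expR (- expR (- (x / eta))).

Lemma gumbel_cdf_nondecreasing : {homo gumbel_cdf : x y / x <= y}.
Proof.
by move=> x y xy; rewrite ler_expR lerN2 ler_expR lerN2 ler_wpM2r// invr_ge0 ltW.
Qed.

Lemma exists_gumbel_law :
  exists mu : probability line R,
    forall x, mu `]-oo, x]%classic = (gumbel_cdf x)%:E.
Proof.
have cE : continuous (fun x : R => expR (- (x / eta))).
  move=> x; apply: continuous_comp; last exact: continuous_expR.
  by apply: cvgN; apply: cvgMl; exact: cvg_id.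
apply: exists_law_of_cdf; first exact: gumbel_cdf_nondecreasing.
- move=> x; apply: continuous_comp; last exact: continuous_expR.
  by apply: cvgN; exact: cE.
- apply: (cvg_comp _ _ _ (@cvgr_expR R)).
  apply/cvgryPge => A; near=> x.
  apply: le_trans (expR_ge1Dx _).
  rewrite -lerBlDl -mulNr ler_pdivlMr// lerNr.
  by near: x; apply: nbhs_ninfty_le; rewrite num_real.
- rewrite -[X in _ --> X]expR0 -[X in expR X]oppr0.
  apply: (@cvg_comp _ _ _ (fun x => - expR (- (x / eta))) expR _
    (nbhs (-0:R))); last exact: continuous_expR.
  apply: cvgN; apply: (cvg_comp _ _ _ (@cvgr_expR R)).
  apply/cvgryPge => A; near=> x.
  by rewrite ler_pdivlMr.
Unshelve. all: by end_near. Qed.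

(** With [w = expR (- (b / eta))] and [h = (b - a) / eta], the increment is at
    most [(w * expR (- w)) * (expR h - 1)], where [w * expR (- w) <= 1] and
    [expR h - 1 <= 2 * h] as long as [h <= 1 / 2]; for larger [h] the bound
    exceeds 1. *)
Lemma gumbel_cdf_lipschitz a b : a <= b ->
  gumbel_cdf b - gumbel_cdf a <= 2 / eta * (b - a).
Proof.
move=> ab; have -> : 2 / eta * (b - a) = 2 * ((b - a) / eta) by ring.
pose h := (b - a) / eta; rewrite -/h.
have h0 : 0 <= h by rewrite divr_ge0 ?subr_ge0// ltW.
have [h_gt|h_le] := ltP (1 / 2) h.
  have : gumbel_cdf b <= 1 by rewrite expR_le1 oppr_le0 expR_ge0.
  have : 0 <= gumbel_cdf a := expR_ge0 _; lra.
rewrite /gumbel_cdf; set w := expR (- (b / eta)).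
have -> : expR (- (a / eta)) = w * expR h.
  by rewrite -expRD /h; congr expR; ring.
have w0 : 0 < w := expR_gt0 _.
have eh : expR h <= 1 + 2 * h.
  by have := mul_subr_expR_le1 h; have := expR_gt0 h; nra.
have we : w * expR (- w) <= 1.
  rewrite expRN ler_pdivrMr ?expR_gt0// mul1r.
  by have := expR_ge1Dx w; lra.
have -> : - (w * expR h) = - w + - (w * (expR h - 1)) by ring.
rewrite expRD; have := expR_ge1Dx (- (w * (expR h - 1))).
set z := expR (- (w * _)) => ez; have ew := expR_gt0 (- w).
have e1 : 0 <= expR h - 1 by have := expR_ge1Dx h; lra.
have : expR (- w) - expR (- w) * z <= (w * expR (- w)) * (expR h - 1) by nra.
nra.
Qed.

(** The closed interval is enclosed in half-open ones, whose mass is an increment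
    of the distribution function. *)
Lemma lipschitz_cdf_itv (mu : probability line R) (F : R -> R) (K a b : R) :
  (forall x, mu `]-oo, x]%classic = (F x)%:E) ->
  (forall x y, x <= y -> F y - F x <= K * (y - x)) -> a <= b ->
  fine (mu `[a, b]%classic) <= K * (b - a).
Proof.
move=> muF FK ab.
have half_open c : c < a -> fine (mu `[a, b]%classic) <= K * (b - c).
  move=> ca; apply: le_trans (FK c b _); last by rewrite (le_trans (ltW ca)).
  rewrite -lee_fin fineK; last exact: fin_num_measure.
  apply: (@le_trans _ _ (mu `]c, b]%classic)).
    by apply: le_measure; rewrite ?inE//; apply: subset_itvr; rewrite bnd_simp.
  have -> : `]c, b]%classic = `]-oo, b]%classic `\` `]-oo, c]%classic.
    by rewrite -[RHS]setCK setCD setCitvl setUC -[LHS]setCK setCitv.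
  rewrite measureD//=; last by rewrite -ge0_fin_numE// fin_num_measure.
  rewrite setIidr ?muF//; apply: subset_itvl; rewrite bnd_simp.
  exact: le_trans (ltW ca) ab.
apply/ler_addgt0Pl => e e0; have K1 : 0 < `|K| + 1 by rewrite ltr_wpDl.
have := half_open (a - e / (`|K| + 1)); rewrite ltrBlDr ltrDl divr_gt0//.
move=> /(_ isT)/le_trans; apply.
have -> : K * (b - (a - e / (`|K| + 1))) = K * (b - a) + e * (K / (`|K| + 1)) by ring.
rewrite addrC lerD2r ler_piMr ?(ltW e0)// ler_pdivrMr// mul1r.
by rewrite (le_trans (ler_norm K))// lerDl.
Qed.

Section GumbelVariable.
Context d (T : measurableType d) (P : probability T R) (X : T -> R).
Hypothesis mX : measurable_fun [set: T] X.
Hypothesis cdfX : forall x, P [set t | (X t <= x)%R] = (gumbel_cdf x)%:E.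

(** The upper tail is at most [expR (- ((n - 1) / eta))], and the lower one,
    doubly exponential, is at most [expR (- (n / eta))]. *)
Lemma integrable_gumbel : P.-integrable [set: T] (fun t => (X t)%:E).
Proof.
pose rho := expR (- (1 / eta)).
have rhoX n : rho ^+ n = expR (- (n%:R / eta)).
  by rewrite /rho -expRM_natl; congr expR; ring.
have mle x : measurable [set t | X t <= x].
  by rewrite -[X in measurable X]setTI; apply: measurable_fun_le.
apply: (@integrable_geometric_tail _ _ _ P X (1 + expR (1 / eta)) rho) => //.
  by rewrite expR_ge0 expR_lt1 oppr_lt0 divr_gt0.
move=> n.
pose lo := [set t | X t <= - n%:R]; pose hi := [set t | X t <= n%:R - 1].
apply: (@le_trans _ _ (P lo + P (~` hi))%E).
  have mhi : measurable (~` hi) by apply: measurableC; exact: mle.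
  have mlo : measurable lo by exact: mle.
  apply: le_trans (measureU2 _ mlo mhi).
  apply: le_measure; rewrite ?inE//=.
  - rewrite -[X in measurable X]setTI; apply: measurable_fun_le => //.
    exact: measurableT_comp.
  - exact: measurableU.
  move=> t /=; rewrite ler_normr => /orP[nX|nX]; [right|left].
    by apply/negP; rewrite -ltNge; lra.
  by rewrite /lo/= lerNr.
rewrite probability_setC; last exact: mle.
rewrite !cdfX -EFinB -EFinD lee_fin rhoX.
rewrite mulrDl mul1r -expRD; apply: lerD.
  rewrite /gumbel_cdf ler_expR lerN2 mulNr opprK.
  by apply: le_trans (expR_ge1Dx _); rewrite lerDr.
have := expR_ge1Dx (- expR (- ((n%:R - 1) / eta))).
rewrite -/(gumbel_cdf _) => cdfn.
have -> : 1 / eta + - (n%:R / eta) = - ((n%:R - 1) / eta) by ring.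
by lra.
Qed.

End GumbelVariable.
End GumbelLaw.

(** * Entropy duality for Gumbel noise *)

Section GumbelNoise.
Variables (R : realType) (M : mdp R) (eta : R).
Hypothesis eta_gt0 : 0 < eta.

(** The joint distribution function over every subset of coordinates, in the form
    in which the distribution function of a maximum over [A] reads off.  For [A] a
    singleton it gives the Gumbel marginals, and it expresses independence. *)
Definition gumbel_noise (P : probability (noise M) R) :=
  forall (A : {set action M}) (v : action M -> R) (x : R),
    P [set e | forall a, a \in A -> v a + ncoord e a <= x] =
    (\prod_(a in A) gumbel_cdf eta (x - v a))%:E.

Lemma exists_gumbel_noise : exists P : probability (noise M) R,
  [/\ abs_continuous P, forall a, P.-integrable setT (fun e => (ncoord e a)%:E) &
    gumbel_noise P].
Proof.
have [mu muG] := exists_gumbel_law eta_gt0.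
have [P iidP] := exists_iid_law mu #|action M|.
exists P; split.
- apply: (iid_abs_continuous iidP (C := 2 / eta)) => a b.
  apply: lipschitz_cdf_itv (muG) _ => x y; exact: gumbel_cdf_lipschitz.
- move=> a; apply: (integrable_gumbel eta_gt0) => [|x].
    exact: measurable_ncoord.
  rewrite -muG -(iid_coordinate iidP (enum_rank a)); last exact: measurable_itv.
  by congr (P _); apply/seteqP; split=> e /=; rewrite in_itv.
move=> A v x.
pose B (i : 'I_#|action M|) : set (measurableTypeR R) :=
  if enum_val i \in A then `]-oo, x - v (enum_val i)]%classic
  else [set: measurableTypeR R].
have -> : [set e : noise M | forall a, a \in A -> v a + ncoord e a <= x] =
    [set e | forall i, B i (tnth e i)].
  apply/seteqP; split=> e /= eA.
    move=> i; rewrite /B; case: ifPn => // iA; rewrite /= in_itv/= lerBrDl.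
    by have := eA _ iA; rewrite /ncoord enum_valK.
  move=> a aA; have := eA (enum_rank a).
  by rewrite /B enum_rankK aA /= in_itv/= lerBrDl.
rewrite iidP; last first.
  by move=> i; rewrite /B; case: ifP => // _; exact: measurable_itv.
congr (_%:E); rewrite [RHS]big_mkcond/= [RHS](reindex_onto enum_val enum_rank)/=.
  apply: eq_big => [i|i _]; first by rewrite enum_valK eqxx.
  by rewrite /B; case: ifP; rewrite ?muG// probability_setT.
by move=> a _; rewrite enum_rankK.
Qed.

Variable P : probability (noise M) R.
Hypotheses (intP : forall a, P.-integrable setT (fun e => (ncoord e a)%:E))
  (gumbelP : gumbel_noise P).

(** Actions outside [A] are excluded, which is how policies that vanish on some
    actions are reached. *)
Definition argmax_rule (A : {set action M}) (v : action M -> R)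
    (f : noise M -> action M) :=
  [/\ finite_valued_measurable f, forall e, f e \in A &
    forall e a, a \in A -> v a + ncoord e a <= v (f e) + ncoord e (f e)].

Lemma exists_argmax_rule (A : {set action M}) v : A != finset.set0 ->
  exists f, argmax_rule A v f.
Proof.
move=> /set0Pn[a0 a0A].
pose Q a (e : noise M) : \bar R := if a \in A then (v a + ncoord e a)%:E else -oo%E.
have mQ a : measurable_fun [set: noise M] (Q a).
  rewrite /Q; case: (a \in A); last exact: measurable_cst.
  apply/measurable_EFinP; apply: measurable_funD => //.
  exact: measurable_ncoord.
have [f mf fQ] := exists_measurable_argmax (action_gt0 M) mQ.
have fA e : f e \in A.
  by have := fQ e a0; rewrite /Q a0A; case: ifP => //; rewrite leeNy_eq.
exists f; split=> // e a aA.
by have := fQ e a; rewrite /Q aA fA lee_fin.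
Qed.

(** The coordinates are identically distributed, so the choice of the action is
    immaterial. *)
Definition gumbel_mean : R :=
  \int[P]_e ncoord e (enum_val (Ordinal (action_gt0 M))).

(** Max-stability.  The maximum of [v a + e a] over [A], lowered by
    [eta * ln (\sum_(a in A) expR (v a / eta))], has the distribution function of
    a single coordinate: the product of the Gumbel functions adds up their inner
    exponentials. *)
Lemma argmax_rule_mean (A : {set action M}) v f : argmax_rule A v f ->
  \sum_a rule_prob P f a * v a + rule_noise P f =
  gumbel_mean + eta * ln (\sum_(a in A) expR (v a / eta)).
Proof.
move=> [mf fA fmax]; set S := \sum_(a in A) _.
have S0 : 0 < S.
  have e0 : noise M := [tuple of nseq #|action M| 0].
  rewrite /S (bigD1 (f e0))//=; apply: ltr_pwDl; first exact: expR_gt0.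
  by apply: sumr_ge0 => a _; exact: expR_ge0.
pose L := eta * ln S; rewrite -/L.
suff : \int[P]_e ((v (f e) - L) + 1 * ncoord e (f e)) = gumbel_mean.
  rewrite (Rintegral_rule_noise intP (fun a => v a - L))// mul1r.
  under eq_bigr do rewrite mulrBr.
  rewrite sumrB -mulr_suml rule_prob_sum1// => <-; ring.
apply: eq_mean_of_cdf.
- have := integrableD measurableT (integrable_rule P (fun a => v a - L) mf)
    (integrable_ncoord_rule intP mf).
  by apply: eq_integrable => // e _ /=; rewrite mul1r EFinD.
- exact: intP.
move=> x; set a0 := enum_val _.
have := gumbelP [set a0]%SET (fun=> 0) x; rewrite big_set1 subr0 => G.
have -> : P [set t | (ncoord t a0 <= x)%R] = (gumbel_cdf eta x)%:E.
  rewrite -G; congr (P _); apply/seteqP; split=> e /= h.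
    by move=> a; rewrite inE add0r => /eqP ->.
  by have := h a0; rewrite inE add0r; exact.
rewrite (_ : mkset _ = [set e | forall a, a \in A -> v a + ncoord e a <= x + L]).
  rewrite gumbelP; congr (_%:E); rewrite /gumbel_cdf -expR_sum sumrN; congr (expR (- _)).
  have -> : - (x / eta) = - ((x + L) / eta) + ln S.
    by rewrite /L; field; rewrite gt_eqF.
  rewrite expRD lnK// /S mulr_sumr; apply: eq_bigr => a _.
  by rewrite -expRD; congr expR; ring.
apply/seteqP; split=> e /= h.
  by move=> a aA; apply: le_trans (fmax e a aA) _; move: h; rewrite mul1r; lra.
by have := h _ (fA e); rewrite mul1r; lra.
Qed.

Definition row_stochastic (p : action M -> R) :=
  (forall a, 0 <= p a) /\ \sum_a p a = 1.

(** Compare [f] with the argmax for [v = eta * ln p]: the mean of the maximum is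
    [c + eta * ln 1 = c], while [f] collects its noise plus
    [\sum_a p a * v a], which is minus the entropy bonus.  An action of
    probability 0 would need [v a = -oo]; it gets [eta * ln delta] instead, at a
    cost of at most [eps]. *)
Lemma rule_noise_le_entropy f : finite_valued_measurable f ->
  rule_noise P f <= gumbel_mean + entropy_reg eta (rule_prob P f).
Proof.
move=> mf; set p := rule_prob P f.
have p0 a : 0 <= p a := rule_prob_ge0 P f a.
have card0 : 0 < #|action M|%:R :> R by rewrite ltr0n action_gt0.
apply/ler_addgt0Pr => eps eps0.
pose delta := eps / (eta * #|action M|%:R).
have delta0 : 0 < delta by rewrite divr_gt0// mulr_gt0.
pose v a := if 0 < p a then eta * ln (p a) else eta * ln delta.
have [|g gmax] := @exists_argmax_rule [set: action M]%SET v.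
  by have /card_gt0P[a0 _] := action_gt0 M; apply/set0Pn; exists a0; rewrite inE.
have [mg _ gv] := gmax.
have := le_Rintegral_rule (P := P) (F := v) (G := v) intP mf mg.
move=> /(_ (fun e => gv e (f e) (finset.in_setT _))).
rewrite (argmax_rule_mean gmax) -/p.
have -> : \sum_a p a * v a = - entropy_reg eta p.
  rewrite /entropy_reg mulNr opprK mulr_sumr; apply: eq_bigr => a _.
  rewrite /v; case: ifPn => [_|]; first by ring.
  rewrite -leNgt => pa; have -> : p a = 0 by apply/eqP; rewrite eq_le pa p0.
  by rewrite !mul0r mulr0.
set S := \sum_(a in [set: action M]%SET) _ => fle.
have SE : S <= 1 + #|action M|%:R * delta.
  rewrite -[X in X + _](rule_prob_sum1 P mf) -/p.
  rewrite -sum1_card natr_sum mulr_suml -big_split/=.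
  rewrite /S [leLHS](eq_bigl xpredT); last by move=> a; exact: finset.in_setT.
  apply: ler_sum => a _; rewrite mul1r /v.
  case: ifPn => [pa|_]; rewrite mulrAC mulfV ?gt_eqF// mul1r lnK ?posrE//.
    by rewrite lerDl ltW.
  by rewrite lerDr.
have S0 : 0 < S.
  rewrite /S; have /card_gt0P[a0 _] := action_gt0 M.
  rewrite (bigD1 a0) ?inE//=; apply: ltr_pwDl; first exact: expR_gt0.
  by apply: sumr_ge0 => a _; exact: expR_ge0.
have lnS : eta * ln S <= eps.
  have -> : eps = eta * (#|action M|%:R * delta).
    by rewrite /delta; field; rewrite !gt_eqF.
  rewrite ler_wpM2l ?(ltW eta_gt0)//.
  have := @le_ln1Dx _ (S - 1); rewrite [1 + _]addrC subrK => lnle.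
  by apply: le_trans (lnle _) _; lra.
by lra.
Qed.

(** The rule is the argmax of [eta * ln (p a) + e a] over the support of [p].  To
    compute its law [P_b], raise the entry [b] by [eta * u]: the mean of the
    maximum goes from [c] to [c + eta * ln (1 + p b * (expR u - 1))], and it is
    at least what the old rule collects, [c + eta * u * P_b].  Small [u] gives
    [P_b <= p b], and two probability vectors so ordered are equal.  The value
    of the noise then follows from the mean of the maximum, which is [c]. *)
Lemma exists_rule_with_law p : row_stochastic p -> exists2 f,
  finite_valued_measurable f &
  (forall a, rule_prob P f a = p a) /\
  rule_noise P f = gumbel_mean + entropy_reg eta p.
Proof.
move=> [p0 p1]; pose A := [set a | 0 < p a]%SET; pose v a := eta * ln (p a).
have A0 : A != finset.set0.
  apply/eqP => A0; have : \sum_a p a = 0.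
    apply: big1 => a _; apply/eqP; rewrite eq_le p0 andbT leNgt.
    apply/negP => pa; have : a \in A by rewrite inE.
    by rewrite A0 inE.
  by rewrite p1 => /eqP; rewrite oner_eq0.
have sumA (F : action M -> R) : (forall a, p a = 0 -> F a = 0) ->
    \sum_(a in A) F a = \sum_a F a.
  move=> F0; rewrite big_mkcond; apply: eq_bigr => a _; case: ifPn => //.
  rewrite inE -leNgt => pa; rewrite F0//.
  by apply/eqP; rewrite eq_le pa p0.
have [f fmax] := exists_argmax_rule v A0; have [mf fA fv] := fmax.
have expv a : a \in A -> expR (v a / eta) = p a.
  by rewrite inE /v mulrAC mulfV ?gt_eqF// mul1r => pa; rewrite lnK.
have fmean := argmax_rule_mean fmax.
have S1 : \sum_(a in A) expR (v a / eta) = 1.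
  by rewrite (eq_bigr _ expv) sumA.
move: fmean; rewrite S1 ln1 mulr0 addr0 => fmean.
have prob_le b : rule_prob P f b <= p b.
  have [bA|bA] := boolP (b \in A); last first.
    rewrite /rule_prob (_ : mkset _ = set0) ?measure0//.
    by apply/seteqP; split=> // e /= fb; move: bA; rewrite -fb fA.
  apply/ler_addgt0Pr => u u0; wlog u1 : u u0 / u < 1.
    move=> H; have [/H|u1] := ltP u 1; first exact.
    apply: le_trans (H (1 / 2) _ _) _; rewrite ?divr_gt0//; lra.
  pose h := eta * u; pose vh a := v a + h * (a == b)%:R.
  have [g gmax] := exists_argmax_rule vh A0; have [mg _ gv] := gmax.
  have := le_Rintegral_rule (P := P) (F := vh) (G := vh) intP mf mg.
  move=> /(_ (fun e => gv e (f e) (fA e))).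
  rewrite (argmax_rule_mean gmax).
  have -> : \sum_a rule_prob P f a * vh a =
      \sum_a rule_prob P f a * v a + h * rule_prob P f b.
    under eq_bigr do rewrite mulrDr.
    rewrite big_split/=; congr (_ + _).
    rewrite (bigD1 b)//= eqxx mulr1 big1 ?addr0 1?mulrC// => a /negbTE ->.
    by rewrite !mulr0.
  have -> : \sum_(a in A) expR (vh a / eta) = 1 + p b * (expR u - 1).
    rewrite -[X in _ = X + _]S1 (bigD1 b)//= [in RHS](bigD1 b)//= expv//.
    have -> : expR (vh b / eta) = p b * expR u.
      rewrite /vh eqxx mulr1 mulrDl expRD expv//; congr (_ * expR _).
      by rewrite /h mulrAC mulfV ?gt_eqF// mul1r.
    rewrite (eq_bigr (fun a => expR (v a / eta))); first by ring.
    by move=> a /andP[_ /negbTE ab]; rewrite /vh ab mulr0 addr0.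
  move: fmean; set s := \sum_a _ => fmean.
  have eu : 0 < expR u - 1 by rewrite subr_gt0 expR_gt1.
  have : ln (1 + p b * (expR u - 1)) <= p b * (expR u - 1).
    apply: le_ln1Dx; apply: lt_le_trans (_ : 0 <= _); first by rewrite ltrN10.
    by rewrite mulr_ge0// ltW.
  set l := ln _ => le1 le2.
  have le3 : u * rule_prob P f b <= p b * (expR u - 1).
    apply: le_trans le1; rewrite -(ler_pM2l eta_gt0) mulrA -/h; lra.
  have le4 : (expR u - 1) * (1 - u) <= u.
    by have := mul_subr_expR_le1 u; lra.
  have Pb1 : rule_prob P f b <= 1.
    rewrite -(rule_prob_sum1 P mf) (bigD1 b)//= lerDl sumr_ge0// => a _.
    exact: rule_prob_ge0.
  have : u * (rule_prob P f b * (1 - u)) <= u * p b.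
    have := p0 b; nra.
  rewrite ler_pM2l// => le5.
  have := rule_prob_ge0 P f b; nra.
have probE a : rule_prob P f a = p a.
  have gap0 b : true -> 0 <= p b - rule_prob P f b by rewrite subr_ge0.
  have sum0 : \sum_a (p a - rule_prob P f a) = 0.
    by rewrite sumrB p1 rule_prob_sum1// subrr.
  by apply/esym/eqP; rewrite -subr_eq0 (psumr_eq0P gap0 sum0).
exists f => //; split=> //.
have -> : entropy_reg eta p = - \sum_a rule_prob P f a * v a.
  rewrite /entropy_reg mulNr mulr_sumr; congr (- _); apply: eq_bigr => a _.
  by rewrite probE /v; ring.
by rewrite -fmean; ring.
Qed.

End GumbelNoise.

(** * Stochastic form of the entropic model *)

Section StochasticReturns.
Variables (R : realType) (M : mdp R) (d : noise_law M).
Local Notation gamma := (discount M).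
Hypothesis int_d : integrable_noise d.

Definition rule_policy (psi : rule M) : policy M := fun s => rule_prob (d s) (psi s).

Definition sgain1 (r : reward M) (psi : rule M) : state M -> R :=
  gain1 (fun s => rule_noise (d s) (psi s)) r (rule_policy psi).

Lemma rule_policyP psi : measurable_rule psi -> is_policy (rule_policy psi).
Proof.
by move=> mpsi; split=> [s a|s]; [exact: rule_prob_ge0|exact: rule_prob_sum1].
Qed.

(** One step integrates, over the noise, a function of the action taken plus a
    multiple of its noise; only the action probabilities and the expected noise of
    the rule survive. *)
Lemma sexpect_hreturn r (psi : nat -> rule M) n t s c :
  (forall t, measurable_rule (psi t)) ->
  sexpect d psi t n s (fun tau => c + sreturn r tau) =
  c + gamma ^+ t *
    hreturn (fun t => rule_policy (psi t)) (fun t => sgain1 r (psi t)) n t s.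
Proof.
move=> mpsi; elim: n t s c => [|n IH] t s c /=.
  by rewrite /sreturn big_nil mulr0.
set h := hreturn _ _ n t.+1.
pose G a := r s a + gamma * \sum_s' trans s a s' * h s'.
rewrite (@eq_Rintegral _ _ _ (d s) setT
  (fun e => (c + gamma ^+ t * G (psi t s e)) + gamma ^+ t * ncoord e (psi t s e))).
  rewrite (Rintegral_rule_noise (int_d s) (fun a => c + gamma ^+ t * G a) _ (mpsi t s)).
  have := policy_avgD s c G (gamma ^+ t) (rule_policyP (mpsi t)).
  rewrite {1}/rule_policy => ->; rewrite -addrA -mulrDr; congr (_ + _ * _).
  rewrite /G /sgain1 /gain1 /next_mean [RHS]addrAC; congr (_ + _).
  under eq_bigr do rewrite mulrDr mulrCA.
  by rewrite big_split/= -mulr_sumr.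
move=> e _; set a := psi t s e.
have E : (fun tau => c + sreturn r ((t, s, a, e) :: tau)) =
    (fun tau => (c + gamma ^+ t * (r s a + ncoord e a)) + sreturn r tau).
  by apply/funext => tau; rewrite /sreturn big_cons/= addrA.
under eq_bigr do rewrite E IH.
by rewrite trans_avgD /G exprSr; ring.
Qed.

Lemma sgain_hreturn r (psi : nat -> rule M) s :
  (forall t, measurable_rule (psi t)) ->
  sgain d r psi s = limn_einf (fun n => (hreturn
    (fun t => rule_policy (psi t)) (fun t => sgain1 r (psi t)) n 0 s)%:E).
Proof.
move=> mpsi; rewrite /sgain; congr limn_einf; apply/funext => n; congr (_%:E).
rewrite -[RHS]mul1r -[1]/(gamma ^+ 0) -[RHS]add0r -sexpect_hreturn//.
by congr sexpect; apply/funext => tau; rewrite add0r.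
Qed.

End StochasticReturns.

Section OptimalRules.
Variables (R : realType) (M : mdp R) (d : noise_law M).

(** A maximum of finitely many extended reals is attained, be the value finite or
    not. *)
Lemma exists_optimal_rule r : exists psi, optimal_rule d r psi.
Proof.
have best s : exists f, finite_valued_measurable f /\
    forall e a, (sQ d r s e a <= sQ d r s e (f e))%E.
  have mQ a : measurable_fun [set: noise M] (fun e => sQ d r s e a).
    apply: emeasurable_funD; last exact: measurable_cst.
    apply/measurable_EFinP; apply: measurable_funD => //.
    exact: measurable_ncoord.
  by have [f mf fQ] := exists_measurable_argmax (action_gt0 M) mQ; exists f.
have [psi psiP] := choice best.
by exists psi; split=> [s|s]; have [] := psiP s.
Qed.

Lemma soptimal_rule_policy r psi : optimal_rule d r psi ->
  soptimal d r (rule_policy d psi).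
Proof.
move=> opt; exists psi => // s a; rewrite /rule_policy /rule_prob fineK//.
by apply: fin_num_measure; have [mpsi _] := opt; exact: mpsi.
Qed.

Lemma equivalent_smodel_refl : equivalent (smodel d) (smodel d).
Proof.
exists (fun _ _ => 0) => rX rY rXY.
have -> : rX = rY.
  by apply/funext => s; apply/funext => a; apply/eqP; rewrite -subr_eq0 rXY.
split=> // _; have [psi opt] := exists_optimal_rule rY.
by exists (rule_policy d psi); split; exact: soptimal_rule_policy.
Qed.

End OptimalRules.

Section EntropicIsStochastic.
Variables (R : realType) (M : mdp R) (eta : R).
Local Notation gamma := (discount M).
Hypothesis eta_gt0 : 0 < eta.
Variable P : probability (noise M) R.
Hypotheses (intP : forall a, P.-integrable setT (fun e => (ncoord e a)%:E))
  (gumbelP : gumbel_noise eta P).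

Let d : noise_law M := fun=> P.
Let int_d : integrable_noise d. Proof. by move=> s; exact: intP. Qed.
Let c := gumbel_mean P.

Section Rewards.
(* The Gumbel mean [c] is collected at every step by the stochastic model. *)
Variables rX rY : reward M.
Hypothesis rXY : forall s a, rX s a - rY s a = - c.

Let gain1_shift (b b' : state M -> R) p s : is_policy p -> b s = c + b' s ->
  gain1 b rX p s = gain1 b' rY p s.
Proof.
move=> [_ p1] bb; rewrite /gain1 bb addrA; congr (_ + _).
rewrite -[X in _ + X]mulr1 -(p1 s) mulr_sumr -big_split/=.
apply: eq_bigr => a _; have -> : rY s a = rX s a + c.
  by have := rXY s a; lra.
by ring.
Qed.

Lemma sgain1_le_egain1 psi s : measurable_rule psi ->
  sgain1 d rX psi s <= egain1 eta rY (rule_policy d psi) s.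
Proof.
move=> mpsi; rewrite /egain1 -(@gain1_shift
  (fun s => c + entropy_reg eta (rule_policy d psi s)))//.
  by rewrite lerD2l; exact: rule_noise_le_entropy.
exact: rule_policyP.
Qed.

Lemma exists_rule_egain1 pi : is_policy pi ->
  exists psi, [/\ measurable_rule psi, rule_policy d psi = pi &
    forall s, sgain1 d rX psi s = egain1 eta rY pi s].
Proof.
move=> ppi; have [pi0 pi1] := ppi.
have rowP s : row_stochastic (pi s) by split.
have ex s : exists f, [/\ finite_valued_measurable f,
    forall a, rule_prob P f a = pi s a &
    rule_noise P f = c + entropy_reg eta (pi s)].
  by have [f ? []] := exists_rule_with_law eta_gt0 intP gumbelP (rowP s); exists f.
have [psi psiP] := choice ex; exists psi.
have lawE : rule_policy d psi = pi.
  apply/funext => s; apply/funext => a; have [_ + _] := psiP s; exact.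
split=> // [s|s]; first by have [] := psiP s.
rewrite /sgain1 lawE; apply: gain1_shift => //.
by have [] := psiP s.
Qed.

(** Rule sequences and policy sequences correspond, with returns ordered one way
    by [sgain1_le_egain1] and equal the other way by [exists_rule_egain1].  The
    comparison is made at every finite horizon, hence for any discount factor. *)
Lemma svalue_evalue s : svalue d rX s = evalue eta rY s.
Proof.
apply/eqP; rewrite eq_le; apply/andP; split.
  apply: ge_ereal_sup => _ [psi /= mpsi <-].
  apply: le_ereal_sup_tmp; have pp t := rule_policyP d (mpsi t).
  exists (egain eta rY (fun t => rule_policy d (psi t)) s).
    by exists (fun t => rule_policy d (psi t)).
  rewrite sgain_hreturn// egain_hreturn//; apply: le_limn_einf => n.
  rewrite lee_fin; apply: le_hreturn => // t s'; exact: sgain1_le_egain1.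
apply: ge_ereal_sup => _ [pi /= ppi <-].
have [psi psiP] := choice (fun t => exists_rule_egain1 (ppi t)).
have mpsi t : measurable_rule (psi t) by have [] := psiP t.
apply: ereal_sup_ubound; exists psi => //.
rewrite sgain_hreturn// egain_hreturn//; congr limn_einf; apply/funext => n.
congr (_%:E); apply: eq_hreturn => t s'; have [_ lawE gE] := psiP t; last exact: gE.
by move=> a; rewrite lawE.
Qed.

(** The policy of [psi] is greedy.  Any competing policy comes from a rule
    [psi'] with the same gains, and [psi] beats [psi'] for each realization of the
    noise, hence in expectation; passing from the expected noise of [psi] to the
    entropy of its policy only increases the gain. *)
Lemma optimal_rule_eoptimal psi : gamma < 1 -> optimal_rule d rX psi ->
  eoptimal eta rY (rule_policy d psi).
Proof.
move=> g1 [mpsi opt]; apply: greedy_eoptimal => //; first exact: rule_policyP.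
move=> pi s ppi; set W := fun s => fine (evalue eta rY s).
have [psi' [mpsi' lawE gE]] := exists_rule_egain1 ppi.
rewrite -gE -lawE.
apply: le_trans (lerD (sgain1_le_egain1 s mpsi) (lexx _)).
have E f : measurable_rule f ->
    sgain1 d rX f s + gamma * next_mean (rule_policy d f) W s =
    \sum_a rule_prob P (f s) a *
      (rX s a + gamma * \sum_s' trans s a s' * W s') + rule_noise P (f s).
  move=> mf; rewrite /sgain1 /gain1 /next_mean addrAC; congr (_ + _).
  under [in RHS]eq_bigr do rewrite mulrDr mulrCA.
  by rewrite big_split/= -mulr_sumr.
have sQE e a : sQ d rX s e a =
    (rX s a + gamma * (\sum_s' trans s a s' * W s') + ncoord e a)%:E.
  rewrite /sQ [X in _ = X%:E]addrAC [RHS]EFinD; congr (_ + _)%E.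
  rewrite EFinM -sumEFin; congr (_ * _)%E.
  apply: eq_bigr => s' _; rewrite EFinM svalue_evalue /W fineK//.
  exact: evalue_fin_num.
rewrite !E//; apply: (le_Rintegral_rule intP (mpsi' s) (mpsi s)) => e.
by have := opt s e (psi' s e); rewrite !sQE lee_fin.
Qed.

End Rewards.

Lemma smodel_equivalent_emodel : equivalent (smodel d) (emodel M eta).
Proof.
exists (fun _ _ => - c) => rX rY rXY; split; first exact: svalue_evalue.
move=> g1; have [psi opt] := exists_optimal_rule d rX.
exists (rule_policy d psi); split; first exact: soptimal_rule_policy.
exact: optimal_rule_eoptimal rXY _ g1 opt.
Qed.

End EntropicIsStochastic.

(** * Strictness *)

Section BoundedNoise.
Variable R : realType.

Lemma measurable_noise_box (M : mdp R) (B : action M -> set R) :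
  (forall a, measurable (B a)) ->
  measurable [set e : noise M | forall a, B a (ncoord e a)].
Proof.
move=> mB; rewrite (_ : mkset _ = \bigcap_(a in [set: action M])
    ((fun e : noise M => ncoord e a) @^-1` B a)).
  apply: fin_bigcap_measurable => // a _; rewrite -[X in measurable X]setTI.
  by apply: measurable_ncoord => //; exact: mB.
by apply/seteqP; split=> e eB a => [_|]; exact: eB.
Qed.

(** Independent uniform coordinates; what matters below is that the law is carried
    by a bounded set. *)
Lemma exists_unit_noise (M : mdp R) : exists P : probability (noise M) R,
  [/\ abs_continuous P, forall a, P.-integrable setT (fun e => (ncoord e a)%:E) &
    P [set e | forall a, 0 <= ncoord e a <= 1] = 1%E].
Proof.
pose mu : probability (measurableTypeR R) R := uniform_prob (@ltr01 R).
have [P iidP] := exists_iid_law mu #|action M|; exists P.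
pose I : set (measurableTypeR R) := `[0, 1]%classic.
have mI : measurable I by exact: measurable_itv.
have coordP a : P [set e : noise M | I (ncoord e a)] = 1%E.
  by rewrite (iid_coordinate iidP (enum_rank a) mI); exact: uniform_unit_itv.
split.
- exact: (iid_abs_continuous iidP (@uniform_itv_le R)).
- move=> a; apply: (@integrable_geometric_tail _ _ _ P _ 2 (1 / 2)).
  + exact: measurable_ncoord.
  + by apply/andP; split; lra.
  have mE n : measurable [set e : noise M | n%:R <= `|ncoord e a|].
    rewrite -[X in measurable X]setTI; apply: measurable_fun_le => //.
    by apply: measurableT_comp => //; exact: measurable_ncoord.
  have mIa : measurable [set e : noise M | I (ncoord e a)].
    rewrite -[X in measurable X]setTI; exact: (measurable_ncoord a).
  move=> [|[|n]].
  + by apply: le_trans (probability_le1 P (mE 0%N)) _; rewrite expr0 lee_fin; lra.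
  + by apply: le_trans (probability_le1 P (mE 1%N)) _; rewrite expr1 lee_fin; lra.
  apply: (@le_trans _ _ (P (~` [set e : noise M | I (ncoord e a)]))).
    apply: le_measure; rewrite ?inE//; first exact: measurableC.
    move=> e /= ne; rewrite /I/= in_itv/= => /andP[e0 e1].
    move: ne; rewrite ger0_norm// => /le_trans/(_ e1).
    by rewrite (_ : 1 = 1%:R)// ler_nat.
  by rewrite probability_setC// coordP subee// lee_fin mulr_ge0// exprn_ge0.
- have unitI : fine (mu I) = 1 by rewrite [mu I]uniform_unit_itv.
  have <- : (\prod_(i < #|action M|) fine (mu I))%:E = 1%E.
    by rewrite big1.
  rewrite -(iidP (fun=> I))//; congr (P _).
  apply/seteqP; split=> e /= h.
    move=> i; have := h (enum_val i); rewrite /ncoord enum_valK.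
    by rewrite /I/= in_itv.
  by move=> a; have := h (enum_rank a); rewrite /I/= in_itv.
Qed.

End BoundedNoise.

Section TwoArmedBandit.
Variable R : realType.

Lemma bandit_trans_sum1 (s : unit) (a : bool) : \sum_(s' : unit) (1 : R) = 1.
Proof. by rewrite big_const cardT enumT unlock/= addr0. Qed.

Lemma bandit_state_gt0 : (0 < #|{: unit}|)%N. Proof. by rewrite card_unit. Qed.

Lemma bandit_action_gt0 : (0 < #|{: bool}|)%N. Proof. by rewrite card_bool. Qed.

Definition bandit : mdp R := @MDP R unit bool (fun _ _ _ => 1) 0
  bandit_state_gt0 bandit_action_gt0 (fun _ _ _ => ler01)
  bandit_trans_sum1 (lexx 0) ler01.

Definition gap_reward : reward bandit := fun _ a => if a then 0 else 2.

Lemma bandit_sQ (d : noise_law bandit) r s e a :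
  sQ d r s e a = (r s a + ncoord e a)%:E.
Proof. by rewrite /sQ /= mul0e adde0. Qed.

Lemma bandit_egain eta r (pi : nat -> policy bandit) s :
  (forall t, is_policy (pi t)) -> egain eta r pi s = (egain1 eta r (pi 0%N) s)%:E.
Proof.
move=> ppi; rewrite egain_hreturn//; apply: cvg_limn_einf.
rewrite -cvg_shiftS (_ : (fun _ => _) = cst (egain1 eta r (pi 0%N) s)).
  exact: cvg_cst.
by apply/funext => n /=; rewrite mul0r addr0.
Qed.

(** A reward gap of 2 exceeds any difference of two noises in the unit interval. *)
Lemma unit_noise_optimal_true (d : noise_law bandit) pi :
  (forall s, d s [set e | forall a, 0 <= ncoord e a <= 1] = 1%E) ->
  soptimal d gap_reward pi -> pi tt true = 0.
Proof.
move=> dI [psi [mpsi opt] piE].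
pose cube := [set e : noise bandit | forall a, 0 <= ncoord e a <= 1].
have mcube : measurable cube.
  rewrite (_ : cube = [set e | forall a, `[0, 1]%classic (ncoord e a)]).
    by apply: (@measurable_noise_box R bandit (fun=> `[0, 1]%classic)) => a;
      exact: measurable_itv.
  by apply/seteqP; split=> e /= h a; have := h a; rewrite /= in_itv.
suff : (d tt [set e | psi tt e = true] <= d tt (~` cube))%E.
  rewrite -piE probability_setC// [d tt cube]dI subee// => pile.
  by apply/eqP; rewrite eq_le -!lee_fin pile piE measure_ge0.
apply: le_measure; rewrite ?inE; [exact: mpsi|exact: measurableC|].
move=> e /= psiE eI; have := opt tt e false.
rewrite psiE !bandit_sQ lee_fin /gap_reward.
by have := eI true; have := eI false; lra.
Qed.

(** By independence the noise of the first action exceeds any threshold while the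
    other one is nonpositive, with positive probability. *)
Lemma gumbel_optimal_true (d : noise_law bandit) (eta : R) r pi :
  0 < eta -> iid_gumbel d eta -> soptimal d r pi -> 0 < pi tt true.
Proof.
move=> eta0 [cdf indep] [psi [mpsi opt] piE].
pose K := r tt false - r tt true.
pose B (a : action bandit) : set R :=
  if a then `]K, +oo[%classic else `]-oo, 0]%classic.
have mB a : measurable (B a) by case: a; exact: measurable_itv.
have cdf' a x : d tt [set e | ncoord e a <= x] = (gumbel_cdf eta x)%:E.
  rewrite -(cdf tt a); congr (d tt _); apply/seteqP; split=> e /=;
  by rewrite ler_pM2r// invr_gt0.
have := indep tt B mB; rewrite /= big_bool /=.
have -> : [set e : noise bandit | B false (ncoord e false)] =
    [set e : noise bandit | ncoord e false <= 0].
  by apply/seteqP; split=> e /=; rewrite in_itv.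
have -> : [set e : noise bandit | B true (ncoord e true)] =
    ~` [set e : noise bandit | ncoord e true <= K].
  by apply/seteqP; split=> e /=; rewrite in_itv/= andbT ltNge => /negP.
have mle a x : measurable [set e : noise bandit | ncoord e a <= x].
  rewrite -[X in measurable X]setTI; apply: measurable_fun_le => //.
  exact: measurable_ncoord.
rewrite probability_setC// !cdf' -EFinB/= => dB.
have mBB : measurable [set e : noise bandit | forall a, B a (ncoord e a)].
  exact: measurable_noise_box.
rewrite -lte_fin piE.
apply: (@lt_le_trans _ _ (d tt [set e : noise bandit | forall a, B a (ncoord e a)])).
  rewrite -[X in (_ < X)%E]fineK ?fin_num_measure// dB lte_fin.
  apply: mulr_gt0; last exact: expR_gt0.
  by rewrite subr_gt0 /gumbel_cdf expR_lt1 oppr_lt0 expR_gt0.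
apply: le_measure; rewrite ?inE; [exact: mBB|exact: mpsi|].
move=> e /= eB; have := opt tt e true; case: (psi tt e) => //.
rewrite !bandit_sQ lee_fin.
have := eB true; have := eB false; rewrite /B /= !in_itv/= andbT /K; lra.
Qed.

(** Were the first action unused, the gain would be [r tt false].  The softmax
    policy has gain [eta * ln Z], where [Z] is the sum of both exponentials, and
    that is larger. *)
Lemma entropic_optimal_true (eta : R) (r : reward bandit) pi :
  0 < eta -> eoptimal eta r pi -> 0 < pi tt true.
Proof.
move=> eta0 [ppi opt]; have [pi0 pi1] := ppi.
rewrite lt_neqAle pi0 andbT eq_sym; apply/eqP => pit.
have pif : pi tt false = 1 by have := pi1 tt; rewrite big_bool/= pit add0r.
pose Z := expR (r tt true / eta) + expR (r tt false / eta).
have Z0 : 0 < Z by rewrite addr_gt0 ?expR_gt0.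
pose p : policy bandit := fun s a => expR (r tt a / eta) / Z.
have pp : is_policy p.
  split=> [s a|s]; first by rewrite divr_ge0 ?expR_ge0 ?ltW.
  by rewrite big_bool/= -mulrDl mulfV ?gt_eqF.
have : (egain eta r (fun=> p) tt <= egain eta r (fun=> pi) tt)%E.
  by rewrite opt; apply: ereal_sup_ubound; exists (fun=> p).
rewrite !bandit_egain// lee_fin /egain1 /gain1 /entropy_reg !big_bool/=.
rewrite pit pif ln1 !mul0r mulr0 !mul1r !add0r mulr0 addr0.
have lnp a : ln (p tt a) = r tt a / eta - ln Z.
  by rewrite /p ln_div ?posrE ?expR_gt0// expRK.
rewrite !lnp.
have -> : p tt true * r tt true + p tt false * r tt false +
  - eta * (p tt true * (r tt true / eta - ln Z) +
    p tt false * (r tt false / eta - ln Z)) =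
  eta * ln Z * (p tt true + p tt false) by field; rewrite gt_eqF.
have -> : p tt true + p tt false = 1 by have := pp.2 tt; rewrite big_bool.
rewrite mulr1 leNgt => /negP; apply.
have -> : r tt false = eta * ln (expR (r tt false / eta)).
  by rewrite expRK; field; rewrite gt_eqF.
by rewrite ltr_pM2l// ltr_ln ?posrE ?expR_gt0// ltrDr expR_gt0.
Qed.

End TwoArmedBandit.

Theorem proposition2 (R : realType) :
  strictly_subsumes (@SMDP R) (@EVMDP R) /\
  strictly_subsumes (@SMDP R) (@ERMDP R).
Proof.
have [P [acP intP unitP]] := exists_unit_noise (bandit R).
have PS : SMDP (smodel (fun _ : state (bandit R) => P)).
  by exists (fun=> P); split=> // s; exact: intP.
pose shifted alpha : reward (bandit R) := fun s a => gap_reward s a - alpha s a.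
have shiftE alpha s a : gap_reward s a - shifted alpha s a = alpha s a :> R.
  by rewrite /shifted opprB addrC subrK.
split; split.
- move=> M Y [d [eta [_ _ cd id ->]]]; exists (smodel d); first by exists d.
  exact: equivalent_smodel_refl.
- exists (bandit R), (smodel (fun=> P)); split=> // Y [d [eta [eta0 gd _ _ ->]]].
  move=> [alpha /(_ _ _ (shiftE alpha))[_ /(_ ltr01)[pi [piX piY]]]].
  have := gumbel_optimal_true eta0 gd piY.
  by rewrite (unit_noise_optimal_true (fun=> unitP) piX) ltxx.
- move=> M Y [eta eta0 ->]; have [Q [acQ intQ gQ]] := exists_gumbel_noise M eta0.
  exists (smodel (fun=> Q)); last exact: smodel_equivalent_emodel.
  by exists (fun=> Q); split=> // s; exact: intQ.
- exists (bandit R), (smodel (fun=> P)); split=> // Y [eta eta0 ->].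
  move=> [alpha /(_ _ _ (shiftE alpha))[_ /(_ ltr01)[pi [piX piY]]]].
  have := entropic_optimal_true eta0 piY.
  by rewrite (unit_noise_optimal_true (fun=> unitP) piX) ltxx.
Qed.
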